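(* Let $\Omega\subset\mathbb{R}^n$ be a bounded $C^2$ domain. Let $u_0\in L^1(\Omega)$ satisfy $-b_1\le u_0\le a$ a.e. in $\Omega$ for some constants $b_1\ge0$ and $0<a<1$. Let $\lambda>0$, $\chi>0$, $T>0$, and let $u_1,u_2$ be solutions of $(P_\lambda)$ in $\Omega\times(0,T)$ (with the same initial value $u_0$). Then $u_1\equiv u_2$ in $\Omega\times(0,T)$.
   Context: $(P_\lambda)$ is the problem $$\frac{\partial u}{\partial t}=\Delta u+\frac{\lambda}{(1-u)^2\left(1+\chi\int_\Omega\frac{dy}{1-u(y,t)}\right)^2}\ \text{ in }\Omega\times(0,T),\quad u=0\ \text{ on }\partial\Omega\times(0,T),\quad u(x,0)=u_0\ \text{ in }\Omega.$$ A solution of $(P_\lambda)$ in $\Omega\times(0,T)$ is a function $u\in C^{2,1}(\Omega\times(0,T))\cap C(\overline\Omega\times(0,T))$, $u<1$, satisfying the equation classically in $\Omega\times(0,T)$ with $u=0$ on $\partial\Omega\times(0,T)$, such that $\sup_{\overline\Omega\times(0,T']}u<1$ for all $0<T'<T$ and $\|u(\cdot,t)-u_0\|_{L^1(\Omega)}\to0$ as $t\to0$. *)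

(* Defs.v *)
From HB Require Import structures.
From mathcomp Require Import all_boot all_order all_algebra.
From mathcomp Require Import all_classical all_reals all_analysis.

Set Implicit Arguments.
Unset Strict Implicit.
Unset Printing Implicit Defensive.

Import Order.TTheory GRing.Theory Num.Theory.
Import numFieldNormedType.Exports.

Local Open Scope classical_set_scope.
Local Open Scope ring_scope.

Definition rV_display : measure_display.
Proof. exact: default_measure_display. Qed.

(* 'rV[R]_n carries the product sigma-algebra of n copies of the Borel
   sigma-algebra of R, built as the library does for n.-tuple T; it contains
   the open sets (open_measurable_rV). *)
Section rV_measurable.
Variables (R : realType) (n : nat).

Let coord (i : 'I_n) (x : 'rV[R]_n) : R := x ord0 i.

Let rV_set0 : g_sigma_preimage coord set0.
Proof. exact: sigma_algebra0. Qed.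

Let rV_setC A : g_sigma_preimage coord A -> g_sigma_preimage coord (~` A).
Proof. exact: sigma_algebraC. Qed.

Let rV_bigcup (F : (set 'rV[R]_n)^nat) :
  (forall i, g_sigma_preimage coord (F i)) ->
  g_sigma_preimage coord (\bigcup_i (F i)).
Proof. exact: sigma_algebra_bigcup. Qed.

HB.instance Definition _ := @isMeasurable.Build rV_display 'rV[R]_n
  (g_sigma_preimage coord) rV_set0 rV_setC rV_bigcup.

End rV_measurable.

Lemma measurable_coord (R : realType) n (i : 'I_n) :
  measurable_fun [set: 'rV[R]_n] (fun x => x ord0 i).
Proof.
move=> _ Y mY; rewrite setTI; apply: sub_sigma_algebra => /=.
rewrite -bigcup_seq/=; exists i => /=; first by rewrite mem_index_enum.
by exists Y => //; rewrite setTI.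
Qed.

Lemma measurable_fun_rVP d (T : measurableType d) (R : realType) n
    (f : T -> 'rV[R]_n) :
  measurable_fun [set: T] f <->
  forall i, measurable_fun [set: T] (fun t => f t ord0 i).
Proof.
split=> [mf i|mf].
  exact: (measurableT_comp (@measurable_coord R n i) mf).
move=> _ A mA; rewrite setTI.
have : preimage_set_system [set: T] f (@measurable _ 'rV[R]_n) `<=` measurable.
  rewrite /measurable/= -g_sigma_preimage_comp.
  apply: smallest_sub; first exact: sigma_algebra_measurable.
  rewrite -bigcup_seq => B [i _] [C mC <-].
  exact: mf.
by apply; exists A => //; rewrite setTI.
Qed.

Section rV_cons.
Variable R : realType.

Definition rV_cons n (p : measurableTypeR R * 'rV[R]_n) : 'rV[R]_n.+1 :=
  row_mx (p.1)%:M p.2.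

Definition rV_uncons n (x : 'rV[R]_n.+1) : measurableTypeR R * 'rV[R]_n :=
  (x ord0 ord0, \row_j x ord0 (lift ord0 j)).

Lemma rV_cons0 n (p : measurableTypeR R * 'rV[R]_n) :
  rV_cons p ord0 ord0 = p.1.
Proof.
have -> : rV_cons p ord0 ord0 = row_mx (p.1)%:M p.2 ord0 (lshift n (@ord0 0)).
  by congr (fun_of_matrix _ _ _); apply/val_inj.
by rewrite row_mxEl mxE eqxx mulr1n.
Qed.

Lemma rV_consS n (p : measurableTypeR R * 'rV[R]_n) (j : 'I_n) :
  rV_cons p ord0 (lift ord0 j) = p.2 ord0 j.
Proof.
have -> : rV_cons p ord0 (lift ord0 j) =
    row_mx (p.1)%:M p.2 ord0 (@rshift 1 n j).
  by congr (fun_of_matrix _ _ _); apply/val_inj.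
by rewrite row_mxEr.
Qed.

Lemma rV_consK n : cancel (@rV_cons n) (@rV_uncons n).
Proof.
move=> [a v]; rewrite /rV_uncons rV_cons0; congr pair.
by apply/rowP => j; rewrite mxE rV_consS.
Qed.

Lemma rV_unconsK n : cancel (@rV_uncons n) (@rV_cons n).
Proof.
move=> x; apply/rowP => i; case: (unliftP ord0 i) => [j|] ->.
  by rewrite rV_consS mxE.
by rewrite rV_cons0.
Qed.

Lemma measurable_rV_cons n : measurable_fun setT (@rV_cons n).
Proof.
apply/measurable_fun_rVP => i; case: (unliftP ord0 i) => [j|] ->.
- under eq_fun do rewrite rV_consS.
  exact: (measurableT_comp (@measurable_coord R n j) measurable_snd).
- under eq_fun do rewrite rV_cons0.
  exact: measurable_fst.
Qed.

Lemma measurable_rV_uncons n : measurable_fun setT (@rV_uncons n).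
Proof.
apply/measurable_fun_pairP; split.
  exact: (@measurable_coord R n.+1 ord0).
apply/measurable_fun_rVP => i; rewrite /comp/=.
under eq_fun do rewrite mxE.
exact: measurable_coord.
Qed.

End rV_cons.

(* Lebesgue measure on 'rV[R]_n, by induction on n: the measure on 'rV[R]_n.+1
   is the image of lebesgue_measure \x lebesgue_rV n under rV_cons. Its value on
   boxes is given by lebesgue_rV_box. *)
Section lebesgue_rV.
Variable R : realType.

Section step.
Variables (n : nat) (mu : {sigma_finite_measure set 'rV[R]_n -> \bar R}).
Local Open Scope ereal_scope.

Definition lebesgue_rV_step : set 'rV[R]_n.+1 -> \bar R :=
  pushforward (lebesgue_measure \x mu) (@rV_cons R n).

Let step0 : lebesgue_rV_step set0 = 0.
Proof. by rewrite /lebesgue_rV_step /pushforward preimage_set0 measure0. Qed.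

Let step_ge0 A : 0 <= lebesgue_rV_step A.
Proof. exact: (measure_ge0 (lebesgue_measure \x mu)). Qed.

Let mpreimage A : measurable A -> measurable (@rV_cons R n @^-1` A).
Proof.
by move=> mA; rewrite -[X in measurable X]setTI; exact: measurable_rV_cons.
Qed.

Let step_sigma_additive : semi_sigma_additive lebesgue_rV_step.
Proof.
move=> F mF tF mUF; rewrite /lebesgue_rV_step /pushforward preimage_bigcup.
apply: measure_semi_sigma_additive.
- by move=> k; exact: mpreimage.
- apply/trivIsetP => /= i j _ _ ij; rewrite -preimage_setI.
  by move/trivIsetP : tF => /(_ _ _ _ _ ij) ->//; rewrite preimage_set0.
- by rewrite -preimage_bigcup; exact: mpreimage.
Qed.

HB.instance Definition _ := isMeasure.Build _ _ _ lebesgue_rV_step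
  step0 step_ge0 step_sigma_additive.

Let step_sigma_finite : sigma_finite setT lebesgue_rV_step.
Proof.
have /sigma_finiteP[F [TF ndF Foo]] := sigma_finiteT (@lebesgue_measure R).
have /sigma_finiteP[G [TG ndG Goo]] := sigma_finiteT mu.
exists (fun k => @rV_uncons R n @^-1` (F k `*` G k)).
  apply/esym/seteqP; split => // x _.
  have [i _ Fi] : (\bigcup_i F i) (rV_uncons x).1 by rewrite -TF.
  have [j _ Gj] : (\bigcup_i G i) (rV_uncons x).2 by rewrite -TG.
  exists (maxn i j) => //; split.
    by move: Fi; apply/subsetPset/ndF/leq_maxl.
  by move: Gj; apply/subsetPset/ndG/leq_maxr.
move=> k; have [mF ?] := Foo k; have [mG ?] := Goo k; split.
  rewrite -[X in measurable X]setTI; apply: measurable_rV_uncons => //.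
  exact: measurableX.
rewrite /lebesgue_rV_step /pushforward -comp_preimage.
rewrite (_ : _ \o _ = id); last by apply/funext => p /=; rewrite rV_consK.
by rewrite preimage_id product_measure1E// lte_mul_pinfty// ge0_fin_numE.
Qed.

HB.instance Definition _ := Measure_isSigmaFinite.Build _ _ _ lebesgue_rV_step
  step_sigma_finite.

End step.

Fixpoint lebesgue_rV n : {sigma_finite_measure set 'rV[R]_n -> \bar R} :=
  match n with
  | 0 => dirac (0 : 'rV[R]_0)
  | n'.+1 => lebesgue_rV_step (lebesgue_rV n')
  end.

Lemma lebesgue_rV_box n (a b : 'rV[R]_n) :
  (forall i, a ord0 i <= b ord0 i) ->
  lebesgue_rV n [set x | forall i, x ord0 i \in `[a ord0 i, b ord0 i]] =
  (\prod_(i < n) (b ord0 i - a ord0 i))%:E.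
Proof.
elim: n a b => [|n IH] a b ab.
  rewrite big_ord0 /= diracE mem_set//= => -[].
  by move=> ?.
pose a' := \row_j a ord0 (lift ord0 j); pose b' := \row_j b ord0 (lift ord0 j).
rewrite /= /lebesgue_rV_step /pushforward big_ord_recl EFinM.
set B' := [set x : 'rV[R]_n | forall i, x ord0 i \in `[a' ord0 i, b' ord0 i]].
have mB' : measurable B'.
  have -> : B' = \bigcap_(i in [set: 'I_n])
      ((fun x : 'rV[R]_n => x ord0 i) @^-1` `[a' ord0 i, b' ord0 i]).
    by apply/seteqP; split=> [x Bx i _|x Bx i]; [exact: Bx|exact: (Bx i)].
  apply: fin_bigcap_measurable; first exact: finite_finset.
  move=> i _; rewrite -[X in measurable X]setTI.
  by apply: measurable_coord => //; exact: measurable_itv.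
rewrite (_ : _ @^-1` _ = `[a ord0 ord0, b ord0 ord0] `*` B'); last first.
  apply/seteqP; split=> -[t v] /=.
    move=> H; split; first by have := H ord0; rewrite rV_cons0.
    by move=> i; have := H (lift ord0 i); rewrite rV_consS !mxE.
  move=> [Ht Hv] i; case: (unliftP ord0 i) => [j|] ->; last by rewrite rV_cons0.
  by rewrite rV_consS; have := Hv j; rewrite !mxE.
rewrite product_measure1E//.
rewrite [X in (X * _)%E]lebesgue_measure_itv/= IH; last by move=> i; rewrite !mxE.
congr (_ * _)%E; last by congr EFin; apply: eq_bigr => i _; rewrite !mxE.
rewrite lte_fin -EFinB; case: ltP => // ba.
have -> : a ord0 ord0 = b ord0 ord0 by apply/eqP; rewrite eq_le ab ba.
by rewrite subrr.
Qed.

End lebesgue_rV.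

Lemma open_measurable_rV (R : realType) n (A : set 'rV[R]_n) :
  open A -> measurable A.
Proof.
move=> oA.
pose box (q : 'rV[rat]_n * 'rV[rat]_n) : set 'rV[R]_n :=
  [set x | forall i, x ord0 i \in `](ratr (q.1 ord0 i)), (ratr (q.2 ord0 i))[].
have mbox q : measurable (box q).
  have -> : box q = \bigcap_(i in [set: 'I_n]) ((fun x : 'rV[R]_n => x ord0 i)
      @^-1` `](ratr (q.1 ord0 i)), (ratr (q.2 ord0 i))[).
    by apply/seteqP; split=> [x Bx i _|x Bx i]; [exact: Bx|exact: (Bx i)].
  apply: fin_bigcap_measurable; first exact: finite_finset.
  move=> i _; rewrite -[X in measurable X]setTI.
  by apply: measurable_coord => //; exact: measurable_itv.
have -> : A = \bigcup_(q in [set q | box q `<=` A]) box q.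
  apply/seteqP; split=> [x Ax|x [q /= qA qx]]; last exact: qA.
  have /nbhs_ballP[e /= e0 eA] : nbhs x A by exact: open_nbhs_nbhs.
  have lo i : exists q : rat, x ord0 i - e < ratr q < x ord0 i.
    have [|q /[!in_itv]/= Hq] := @rat_in_itvoo R (x ord0 i - e) (x ord0 i).
      by rewrite ltrBlDr ltrDl.
    by exists q.
  have hi i : exists q : rat, x ord0 i < ratr q < x ord0 i + e.
    have [|q /[!in_itv]/= Hq] := @rat_in_itvoo R (x ord0 i) (x ord0 i + e).
      by rewrite ltrDl.
    by exists q.
  have [p Hp] := choice lo; have [q Hq] := choice hi.
  exists (\row_i p i, \row_i q i); last first.
    move=> i /=; rewrite in_itv/= !mxE.
    by have /andP[_ ->] := Hp i; have /andP[-> _] := Hq i.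
  move=> y By; apply: eA; split=> // i j; rewrite ord1 /ball/= ltr_distlC.
  have := By j; rewrite in_itv/= !mxE => /andP[py yq].
  have /andP[Hp1 _] := Hp j; have /andP[_ Hq2] := Hq j.
  by rewrite (lt_trans Hp1 py) (lt_trans yq Hq2).
rewrite bigcup_mkcond; apply: countable_bigcupT_measurable => [|q].
  exact: countableP.
by case: ifP.
Qed.

Section calculus.
Variables (R : realType) (n : nat).
Implicit Types (U Omega : set 'rV[R]_n) (f : 'rV[R]_n -> R).
Implicit Types (u : 'rV[R]_n -> R -> R).

Definition unit_vec (i : 'I_n) : 'rV[R]_n := delta_mx ord0 i.

Definition partial (i : 'I_n) f : 'rV[R]_n -> R := 'D_(unit_vec i) f.

Definition laplacian f (x : 'rV[R]_n) : R :=
  \sum_(i < n) partial i (partial i f) x.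

Definition continuous_on U f := forall x, U x -> {for x, continuous f}.

(* For open U: 'D_v f x only depends on f near x. *)
Definition C2_on U f :=
  [/\ continuous_on U f,
      forall i, (forall x, U x -> derivable f x (unit_vec i)) /\
                continuous_on U (partial i f)
    & forall i j,
        (forall x, U x -> derivable (partial i f) x (unit_vec j)) /\
        continuous_on U (partial j (partial i f))].

Definition jointly_continuous_on (Q : set ('rV[R]_n * R)) u :=
  forall p, Q p -> {for p, continuous (fun q : 'rV[R]_n * R => u q.1 q.2)}.

Definition C21_on (Q : set ('rV[R]_n * R)) u :=
  [/\ jointly_continuous_on Q u,
      (forall x t, Q (x, t) -> derivable (u x) t 1) /\
      jointly_continuous_on Q (fun x t => derive1 (u x) t),
      forall i,
        (forall x t, Q (x, t) -> derivable (u ^~ t) x (unit_vec i)) /\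
        jointly_continuous_on Q (fun x t => partial i (u ^~ t) x)
    & forall i j,
        (forall x t, Q (x, t) ->
           derivable (partial i (u ^~ t)) x (unit_vec j)) /\
        jointly_continuous_on Q (fun x t => partial j (partial i (u ^~ t)) x)].

End calculus.

Section domain.
Variables (R : realType) (n : nat).
Implicit Type Omega : set 'rV[R]_n.

Definition boundary Omega := closure Omega `\` interior Omega.

(* Near each boundary point, Omega is the region strictly above or below
   (according to s) the graph, in the i-th coordinate direction, of a C^2
   function of the remaining n - 1 coordinates col' i x. The norm on 'rV[R]_n
   is the sup norm, so that ball x0 r is a cube; as r is existentially
   quantified, Euclidean balls would give the same notion. *)
Definition C2_boundary Omega :=
  forall x0 : 'rV[R]_n, boundary Omega x0 ->
  exists (r : R) (i : 'I_n) (s : bool) (g : 'rV[R]_n.-1 -> R),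
    [/\ 0 < r, C2_on setT g
      & forall x : 'rV[R]_n, ball x0 r x ->
          (Omega x <-> g (col' i x) < (-1) ^+ s * x ord0 i)].

Definition bounded_C2_domain Omega :=
  [/\ open Omega, connected Omega, Omega !=set0,
      bounded_set Omega & C2_boundary Omega].

End domain.

Section problem.
Variables (R : realType) (n : nat) (Omega : set 'rV[R]_n).
Variables (u0 : 'rV[R]_n -> R) (lambda chi T : R).

(* The values of u off closure Omega `*` ]0, T[ are irrelevant. The last two
   clauses use extended reals, so that neither the supremum nor the integral
   takes a default value. *)
Definition is_solution (u : 'rV[R]_n -> R -> R) :=
  [/\ C21_on (Omega `*` `]0, T[) u,
      {within closure Omega `*` `]0, T[,
         continuous (fun p : 'rV[R]_n * R => u p.1 p.2)} &
  [/\ forall (x : 'rV[R]_n) (t : R), closure Omega x -> 0 < t < T -> u x t < 1,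
      forall (x : 'rV[R]_n) (t : R), Omega x -> 0 < t < T ->
        derive1 (u x) t = laplacian (u ^~ t) x +
          lambda / ((1 - u x t) ^+ 2 *
            (1 + chi * \int[lebesgue_rV R n]_(y in Omega) (1 - u y t)^-1) ^+ 2),
      forall (x : 'rV[R]_n) (t : R), boundary Omega x -> 0 < t < T -> u x t = 0,
      forall T' : R, 0 < T' < T ->
        (ereal_sup [set (u x t)%:E | x in closure Omega & t in `]0%R, T'] ] < 1)%E
    & (\int[lebesgue_rV R n]_(x in Omega) `|u x t - u0 x|%:E)%E
        @[t --> (0 : R)^'+] --> 0%E]].

End problem.

(* Main.v *)
(** The difference w = u1 - u2 satisfies w_t = Laplacian w + f, and on (0, T']
    with T' < T the bound sup u_i < 1 gives |f| <= L |w| + M ||w||_1. Multiply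
    the equation by psi(w), where psi is a C^1 nondecreasing approximation of the
    sign function vanishing on [-e, e]. As w = 0 on the boundary, the set
    {|w| >= e} is a compact subset of Omega at each time, so psi(w) grad w,
    extended by 0, is a compactly supported C^1 field on the whole space and its
    divergence integrates to 0; no regularity of the boundary is involved. With
    phi' = psi this yields d/dt (int phi(w)) <= C ||w||_1, hence, by Gronwall and
    letting e tend to 0, ||w(t)||_1 <= exp(C (t - s)) ||w(s)||_1 for
    0 < s <= t < T'. Finally ||w(s)||_1 -> 0 as s -> 0 because both solutions have
    the same initial value. *)

Require Import Defs.
From mathcomp Require Import all_boot all_order all_algebra.
From mathcomp Require Import all_classical all_reals all_analysis.
From mathcomp Require Import measurable_realfun ring lra.

Set Implicit Arguments.
Unset Strict Implicit.
Unset Printing Implicit Defensive.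

Import Order.TTheory GRing.Theory Num.Theory.
Import numFieldNormedType.Exports.

Local Open Scope classical_set_scope.
Local Open Scope ring_scope.

(** * Integration of partial derivatives over the whole space *)

Lemma continuous_pairl (T U : topologicalType) (a : T) :
  continuous (fun v : U => (a, v)).
Proof.
by move=> v; apply: (@cvg_pair U T U (nbhs v)); [exact: cvg_cst|exact: cvg_id].
Qed.

Lemma continuous_pairr (T U : topologicalType) (v : U) :
  continuous (fun a : T => (a, v)).
Proof.
by move=> a; apply: (@cvg_pair T T U (nbhs a)); [exact: cvg_id|exact: cvg_cst].
Qed.

Section rV.
Variable R : realType.

Lemma continuous_compact_bounded (T : topologicalType) (K : set T) (f : T -> R) :
  compact K -> {within K, continuous f} ->
  exists C, forall x, K x -> `|f x| <= C.
Proof.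
move=> cK cf; have /compact_bounded[N [_ hN]] := continuous_compact cf cK.
by exists (N + 1) => x Kx; apply: hN; [rewrite ltrDl|exists x].
Qed.

Lemma ler_coord_norm n (x : 'rV[R]_n) i : `|x ord0 i| <= `|x|.
Proof.
rewrite [leRHS]/Num.norm /= mx_normrE.
by apply/bigmax_geP; right => /=; exists (ord0, i).
Qed.

(** * Cubes, and integrability of continuous functions supported in them *)

Definition cube n (M : R) : set 'rV[R]_n :=
  [set x | forall i, x ord0 i \in `[- M, M]].

Lemma compact_cube n M : compact (@cube n M).
Proof.
apply: (@rV_compact _ _ (fun=> `[- M, M]%classic)) => _.
exact: segment_compact.
Qed.

Lemma measurable_box n (a b : 'I_n -> R) :
  measurable [set x : 'rV[R]_n | forall i, x ord0 i \in `[a i, b i]].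
Proof.
have -> : [set x : 'rV[R]_n | forall i, x ord0 i \in `[a i, b i]] =
    \bigcap_(i in [set: 'I_n])
      ((fun x : 'rV[R]_n => x ord0 i) @^-1` `[a i, b i]).
  by apply/seteqP; split=> [x Bx i _|x Bx i]; [exact: Bx|exact: (Bx i)].
apply: fin_bigcap_measurable; first exact: finite_finset.
move=> i _; rewrite -[X in measurable X]setTI.
by apply: measurable_coord => //; exact: measurable_itv.
Qed.

Lemma measurable_cube n M : measurable (@cube n M).
Proof. exact: (measurable_box (fun=> - M) (fun=> M)). Qed.

Lemma lebesgue_cube_lty n M : (lebesgue_rV R n (@cube n M) < +oo)%E.
Proof.
(* For [M < 0] the cube is empty in positive dimension, whereas in dimension 0 the coordinate
   condition is vacuous and the cube is the single point, of mass 1. *)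
have [M0|M0] := leP 0 M; last first.
  case: n => [|n].
    by rewrite /= diracE ltry.
  rewrite (_ : cube M = set0) ?measure0//.
  apply/seteqP; split=> // x /(_ ord0); rewrite in_itv/= => /andP[h1 h2].
  lra.
rewrite (_ : cube M = [set x : 'rV[R]_n | forall i,
  x ord0 i \in `[(\row_(j < n) - M) ord0 i, (\row_(j < n) M) ord0 i]]); last first.
  by apply/seteqP; split=> x Bx i; have := Bx i; rewrite !mxE.
by rewrite lebesgue_rV_box ?ltry// => i; rewrite !mxE ge0_cp.
Qed.

Lemma bounded_set_cube n (U : set 'rV[R]_n) :
  bounded_set U -> exists M, U `<=` cube M.
Proof.
move=> [M [_ hM]]; exists (M + 1) => x Ux i.
rewrite in_itv/= -ler_norml (le_trans (ler_coord_norm _ _))//.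
by apply: hM Ux; rewrite ltrDl.
Qed.

Lemma continuous_on_measurable_fun n (U : set 'rV[R]_n) f :
  open U -> continuous_on U f -> measurable_fun U f.
Proof.
move=> oU cf; apply: (measurability _ (RGenOpens.measurableE R)).
move=> _ [_ [a [b ->]] <-].
apply: open_measurable_rV; rewrite openE => x [Ux fx].
apply: filterI; first exact: open_nbhs_nbhs.
apply: (cf x Ux); apply: open_nbhs_nbhs; split => //.
Qed.

(** The function equals its restriction to the cube, a compact set of finite measure on which
    continuity makes it bounded. *)
Lemma integrable_bounded_support n (f : 'rV[R]_n -> R) M :
  continuous f -> (forall x, ~ cube M x -> f x = 0) ->
  (lebesgue_rV R n).-integrable setT (EFin \o f).
Proof.
move=> cf f0.
have -> : EFin \o f = (EFin \o f) \_ (cube M).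
  apply/funext => x; rewrite patchE; case: ifPn => //.
  by rewrite notin_setE => /f0 /= ->.
apply/(integrable_mkcond _ (measurable_cube M)).
apply: measurable_bounded_integrable => //.
- exact: measurable_cube.
- exact: lebesgue_cube_lty.
- apply: measurable_funTS; apply: continuous_on_measurable_fun.
    exact: openT.
  by move=> x _; exact: cf.
- have [C fC] := continuous_compact_bounded (compact_cube (M:=M))
    (continuous_subspaceT (A := cube M) cf).
  exists C; split; first exact: num_real.
  by move=> C' /ltW CC' x /fC /le_trans; exact.
Qed.

(** * Splitting off the first coordinate, and integrals of partial derivatives *)

Lemma continuous_rV_cons n : continuous (@rV_cons R n).
Proof.
move=> p; apply/cvg_ballP => e e0.
have cf0 : \forall q \near p, ball p.1 e q.1.
  have : (fun q : measurableTypeR R * 'rV[R]_n => q.1) @ p --> p.1.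
    exact: cvg_fst.
  by move/cvg_ball => /(_ e e0).
pose P k (q : measurableTypeR R * 'rV[R]_n) := ball (p.2 ord0 k) e (q.2 ord0 k).
have cfS : \forall q \near p, forall k : 'I_n, P k q.
  apply: (@filter_forall _ _ P _ (nbhs_filter p)) => k.
  have : (fun q : measurableTypeR R * 'rV[R]_n => q.2 ord0 k) @ p
      --> p.2 ord0 k.
    apply: (@continuous_comp _ _ _ snd (fun v : 'rV[R]_n => v ord0 k)).
      exact: cvg_snd.
    exact: coord_continuous.
  by move/cvg_ball => /(_ e e0).
near=> q; split=> // i j; rewrite ord1.
case: (unliftP ord0 j) => [k|] ->.
  by rewrite !rV_consS; move: k; near: q.
by rewrite !rV_cons0; near: q.
Unshelve. all: by end_near. Qed.

(** The difference quotients of [g \o c] at [a] along [v] are literally those of [g] at [c a] along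
    [w]. With [c] a coordinate slice, this identifies derivatives on the slice with partial
    derivatives on the whole space. *)
Lemma derivable_affine (V W : normedModType R) (c : V -> W) v w (g : W -> R) a :
  (forall h b, c (h *: v + b) = h *: w + c b) ->
  derivable (g \o c) a v = derivable g (c a) w.
Proof.
by move=> cE; rewrite /derivable; under eq_fun do rewrite /= cE.
Qed.

Lemma derive_affine (V W : normedModType R) (c : V -> W) v w (g : W -> R) a :
  (forall h b, c (h *: v + b) = h *: w + c b) ->
  'D_v (g \o c) a = 'D_w g (c a).
Proof.
by move=> cE; rewrite /derive; under eq_fun do rewrite /= cE.
Qed.

Lemma near_derive0 (V : normedModType R) (f : V -> R) x v :
  (\forall y \near x, f y = 0) -> 'D_v f x = 0.
Proof.
move=> f0; rewrite -[RHS](derive_cst (0 : R) x v); exact: near_eq_derive.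
Qed.

Lemma near_eq0_closed (T : topologicalType) (K : set T) (f : T -> R) x :
  closed K -> (forall y, ~ K y -> f y = 0) -> ~ K x -> \forall y \near x, f y = 0.
Proof.
move=> cK f0 Kx; have : nbhs x (~` K).
  by apply: open_nbhs_nbhs; split => //; exact: closed_openC.
by apply: filterS => y; exact: f0.
Qed.

Lemma integral_derive1_support0 (f : R -> R) M :
  (forall x, derivable f x 1) -> continuous (derive1 f) ->
  (forall x, ~ `[- M, M]%classic x -> f x = 0) ->
  (\int[lebesgue_measure]_x (derive1 f x)%:E = 0)%E.
Proof.
move=> df cf' f0.
have f'0 x : ~ `[- M, M]%classic x -> derive1 f x = 0.
  move=> xM; rewrite derive1E near_derive0//.
  by apply: near_eq0_closed f0 xM; exact: itv_closed.
have cf : continuous f.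
  by move=> x; apply/differentiable_continuous/derivable1_diffP.
(* Positive and larger than [M] whatever the sign of [M]: the interval from [- b] to [b] is
   nondegenerate, contains the support, and [f] vanishes at both ends. *)
pose b := `|M| + 1.
have f0b x : b <= `|x| -> f x = 0.
  move=> bx; apply: f0 => /=; rewrite in_itv/= -ler_norml => xM.
  have := le_trans bx xM; have := ler_norm M; rewrite /b; lra.
have -> : (fun x => (derive1 f x)%:E) = (EFin \o (derive1 f)) \_ `[- b, b].
  apply/funext => x; rewrite patchE; case: ifPn => //.
  rewrite notin_setE /= => xb; rewrite f'0// => xM; apply: xb.
  move: xM; rewrite /= !in_itv/= -!ler_norml => xM.
  by rewrite /b (le_trans xM)// (le_trans (ler_norm M))// lerDl.
have b0 : 0 < b by rewrite ltr_wpDl.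
rewrite -integral_mkcond (continuous_FTC2 (F := f)).
- by rewrite !f0b ?subee// ?normrN ger0_norm// ltW.
- by rewrite gtrN.
- exact: continuous_subspaceT.
- split=> [x _||]; first exact: df.
    exact/cvg_at_right_filter/cf.
  exact/cvg_at_left_filter/cf.
- by [].
Qed.

Lemma rV_axpyE n h (u v : 'rV[R]_n) i :
  (h *: u + v) ord0 i = h * u ord0 i + v ord0 i.
Proof. by rewrite !mxE. Qed.

Lemma rV_cons_unit0 n (h : R) (b : R) (v : 'rV[R]_n) :
  rV_cons (h *: 1 + b, v) = h *: unit_vec R ord0 + rV_cons (b, v).
Proof.
apply/rowP => i; rewrite rV_axpyE; case: (unliftP ord0 i) => [j|] ->.
  by rewrite !rV_consS/= mxE eqxx [_ == ord0]eq_sym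
    (negbTE (neq_lift _ _)) mulr0 add0r.
by rewrite !rV_cons0/= mxE !eqxx.
Qed.

Lemma rV_cons_unitS n (j : 'I_n) (h : R) (a : R) (v : 'rV[R]_n) :
  rV_cons (a, h *: unit_vec R j + v) =
  h *: unit_vec R (lift ord0 j) + rV_cons (a, v).
Proof.
apply/rowP => i; rewrite rV_axpyE; case: (unliftP ord0 i) => [k|] ->.
  by rewrite !rV_consS/= rV_axpyE !mxE (inj_eq lift_inj).
by rewrite !rV_cons0/= mxE (negbTE (neq_lift _ _)) andbF mulr0 add0r.
Qed.

Lemma cube_rV_cons n M (a : R) (v : 'rV[R]_n) :
  cube M (rV_cons (a, v)) <-> a \in `[- M, M] /\ cube M v.
Proof.
split=> [H|[aM vM] i].
  by split=> [|j]; [have := H ord0; rewrite rV_cons0|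
    have := H (lift ord0 j); rewrite rV_consS].
case: (unliftP ord0 i) => [j|] ->; rewrite ?rV_cons0 ?rV_consS//.
Qed.

(** [lebesgue_rV R n.+1] is by definition the image of the product measure under [rV_cons], so this
    is the change of variables for an image measure, applied to the absolute value. It makes Fubini
    available. *)
Lemma integrable_rV_cons n (f : 'rV[R]_n.+1 -> R) :
  (lebesgue_rV R n.+1).-integrable setT (EFin \o f) ->
  (lebesgue_measure \x lebesgue_rV R n)%E.-integrable setT
     (EFin \o f \o @rV_cons R n).
Proof.
move=> /integrableP[mf foo]; apply/integrableP; split.
  exact: (measurableT_comp mf (@measurable_rV_cons R n)).
apply: le_lt_trans foo; rewrite [leRHS]ge0_integral_pushforward//.
- exact: measurable_rV_cons.
- exact: measurableT_comp.
Qed.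

Lemma integral_rV_cons n (f : 'rV[R]_n.+1 -> R) :
  (lebesgue_rV R n.+1).-integrable setT (EFin \o f) ->
  (\int[lebesgue_rV R n.+1]_x (f x)%:E =
   \int[(lebesgue_measure \x lebesgue_rV R n)%E]_p (f (rV_cons p))%:E)%E.
Proof.
move=> intf; have [mf _] := integrableP _ _ _ intf.
rewrite [LHS]integral_pushforward//.
- exact: measurable_rV_cons.
- exact: integrable_rV_cons.
Qed.

Lemma closed_cube n M : closed (@cube n M).
Proof.
apply: compact_closed; last exact: compact_cube.
exact: norm_hausdorff.
Qed.

Lemma partial_support0 n i (g : 'rV[R]_n -> R) M x :
  (forall x, ~ cube M x -> g x = 0) -> ~ cube M x -> partial i g x = 0.
Proof.
move=> g0 xM; apply: near_derive0; apply: near_eq0_closed g0 xM.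
exact: closed_cube.
Qed.

(** Induction on the dimension with Fubini. The order of integration puts the differentiated
    coordinate inside, where the integral already vanishes: by the one-dimensional case for the
    first coordinate, by the induction hypothesis for the others. *)
Lemma integral_partial_support0 n (i : 'I_n) (g : 'rV[R]_n -> R) M :
  (forall x, derivable g x (unit_vec R i)) -> continuous (partial i g) ->
  (forall x, ~ cube M x -> g x = 0) ->
  (\int[lebesgue_rV R n]_x (partial i g x)%:E = 0)%E.
Proof.
elim: n => [|n IH] in i g *; first by case: i.
move=> dg cg g0.
have intg : (lebesgue_rV R n.+1).-integrable setT (EFin \o partial i g).
  by apply: (integrable_bounded_support cg) => x; exact: partial_support0 g0.
rewrite integral_rV_cons//.
have := integrable_rV_cons intg.
case: (unliftP ord0 i) => [j|] ->{i} in dg cg intg *; move=> intgc.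
- rewrite -(integral12_prod_meas1 intgc); apply: integral0_eq => a _ /=.
  have cE (h : R) (v : 'rV[R]_n) := rV_cons_unitS j h a v.
  rewrite /fubini_F /=.
  have gE v : partial (lift ord0 j) g (rV_cons (a, v)) =
      partial j (fun v => g (rV_cons (a, v))) v.
    by rewrite /partial -(derive_affine _ _ cE).
  under eq_integral do rewrite gE.
  apply: IH => [v||v vM].
  + by rewrite (derivable_affine _ _ cE).
  + rewrite (_ : partial _ _ =
      partial (lift ord0 j) g \o (fun v => rV_cons (a, v))).
      move=> v; apply: continuous_comp; last exact: cg.
      apply: (@continuous_comp _ _ _ (fun v => (a, v)) (@rV_cons R n)).
        exact: continuous_pairl.
      exact: continuous_rV_cons.
    by apply/funext => v; rewrite -gE.
  + by apply: g0 => /cube_rV_cons[].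
- rewrite -(integral21_prod_meas1 intgc); apply: integral0_eq => v _ /=.
  have cE (h a : R) := rV_cons_unit0 h a v.
  rewrite /fubini_G /=.
  have gE a : partial ord0 g (rV_cons (a, v)) =
      derive1 (fun a => g (rV_cons (a, v))) a.
    by rewrite /partial derive1E -(derive_affine _ _ cE).
  under eq_integral do rewrite gE.
  apply: (@integral_derive1_support0 _ M) => [a||a aM].
  + by rewrite (derivable_affine _ _ cE).
  + rewrite (_ : derive1 _ = partial ord0 g \o (fun a => rV_cons (a, v))).
      move=> a; apply: continuous_comp; last exact: cg.
      apply: (@continuous_comp _ _ _ (fun a => (a, v)) (@rV_cons R n)).
        exact: continuous_pairr.
      exact: continuous_rV_cons.
    by apply/funext => a; rewrite -gE.
  + by apply: g0 => /cube_rV_cons[].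
Qed.

End rV.

(** * A C^2 approximation of the absolute value *)

Section smooth_abs.
Variable R : realType.
Implicit Types (F f : R -> R) (r s e : R).

Lemma is_derive_affine (V W : normedModType R) (c : V -> W) v w (g : W -> R) a d :
  (forall h b, c (h *: v + b) = h *: w + c b) ->
  is_derive a v (g \o c) d <-> is_derive (c a) w g d.
Proof.
move=> cE; have D := derivable_affine g a cE; have E := derive_affine g a cE.
by split=> -[]; rewrite ?D ?E => dg gE; split=> //; rewrite ?D ?E// -?D -?E.
Qed.

(* The library's chain rule for 'D_v asks for differentiability of [g]; here only
   the derivative in the direction [v] is assumed. *)
Lemma is_derive_comp_dir (V : normedModType R) (f : R -> R) (g : V -> R) x v a b :
  is_derive (g x) 1 f a -> is_derive x v g b -> is_derive x v (f \o g) (a * b).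
Proof.
pose c (h : R) := h *: v + x.
have cE h k : c (h *: 1 + k) = h *: v + c k.
  by rewrite /c scalerDl [h *: 1]mulr1 addrA.
have c0 : c 0 = x by rewrite /c scale0r add0r.
rewrite -{2 3}c0 => df dg; apply/(is_derive_affine _ _ _ cE).
have dgc : is_derive (0 : R) 1 (g \o c) b by apply/(is_derive_affine _ _ _ cE).
by apply: (@is_derive1_comp R f (g \o c)); rewrite /= ?c0.
Qed.

Lemma is_derive_pos_part F f : F 0 = 0 -> f 0 = 0 ->
  (forall r, 0 <= r -> is_derive r 1 F (f r)) ->
  forall s, is_derive s 1 (fun s => F (Num.max s 0)) (f (Num.max s 0)).
Proof.
move=> F0 f0 dF s; have [s0|s0|->] := ltgtP s 0.
- rewrite f0; apply: (near_eq_is_derive (f := cst 0)).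
  by apply: filterS (lt_nbhsl s0) => t /ltW t0; rewrite max_r ?F0.
- apply: (near_eq_is_derive (f := F)); last exact/dF/ltW.
  by apply: filterS (lt_nbhsr s0) => t /ltW t0; rewrite max_l.
(* At the kink, Caratheodory's criterion holds with the slope function of [F] precomposed with the
   positive part; on the left it takes the constant value [g 0 = f 0 = 0], which matches the
   vanishing increments. *)
- rewrite f0; have /is_derive1_caratheodory[g [gE cg g0]] := dF 0 (lexx 0).
  apply/is_derive1_caratheodory; exists (fun z => g (Num.max z 0)); split.
  + move=> z; rewrite maxxx F0 !subr0; have [z0|z0] := leP z 0.
      by rewrite F0 g0 f0 mul0r.
    by have := gE z; rewrite F0 !subr0.
  + apply: (@continuous_comp _ _ _ (fun z : R => Num.max z 0) g).
      apply: continuous_max; [exact: cvg_id|exact: cvg_cst].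
    by rewrite maxxx.
  + by rewrite maxxx g0.
Qed.

Lemma is_derive_quot e r : 0 < e -> 0 <= r ->
  is_derive r 1 (fun r => r / (r + e)) (e / (r + e) ^+ 2).
Proof.
move=> e0 r0; have re : r + e != 0 by rewrite gt_eqF// ltr_wpDl.
have dre : is_derive r 1 (id + cst e : R -> R) 1.
  by apply: is_derive_eq; rewrite addr0.
have dV := is_deriveV (f := id + cst e) re dre.
apply: (is_derive_eq (is_deriveM (is_derive_id r 1) dV)).
rewrite /= /GRing.scale/=; change ((id + cst e) r) with (r + e); field.
exact: re.
Qed.

(* With [r = max (s - e) 0] and [q = r / (r + e)], the function [r * q ^+ 2]
   vanishes to third order at [r = 0], hence is C^2 in [s], and differs from [r]
   by [e * q * (1 + q) <= 2 * e]. *)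
Definition ramp e s : R := let r := Num.max (s - e) 0 in r * (r / (r + e)) ^+ 2.
(** For [q = r / (r + e)] one has r q' = q (1 - q), so the derivative of r q^2 with respect to r is
    3 q^2 - 2 q^3, which rises from 0 to 1 on [0, 1]. Differentiating once more gives 6 q (1 - q)
    q', which is [ddramp]. *)
Definition dramp e s : R := let q := Num.max (s - e) 0 / (Num.max (s - e) 0 + e) in
   q ^+ 2 * (3 - 2 * q).
Definition ddramp e s : R := let r := Num.max (s - e) 0 in
  6 * (r / (r + e)) * (1 - r / (r + e)) * (e / (r + e) ^+ 2).

Lemma is_derive_shift_pos_part F f e : F 0 = 0 -> f 0 = 0 ->
  (forall r, 0 <= r -> is_derive r 1 F (f r)) ->
  forall s, is_derive s 1 (fun s => F (Num.max (s - e) 0)) (f (Num.max (s - e) 0)).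
Proof.
move=> F0 f0 dF s.
have ds : is_derive s 1 (id - cst e : R -> R) 1.
  by apply: is_derive_eq; rewrite subr0.
have := is_derive1_comp (g := id - cst e) (is_derive_pos_part F0 f0 dF _) ds.
by rewrite mulr1.
Qed.

Lemma is_derive_ramp e s : 0 < e -> is_derive s 1 (ramp e) (dramp e s).
Proof.
move=> e0; apply: (@is_derive_shift_pos_part (fun r => r * (r / (r + e)) ^+ 2)
   (fun r => (r / (r + e)) ^+ 2 * (3 - 2 * (r / (r + e))))).
- by rewrite mul0r.
- by rewrite mul0r expr0n mul0r.
- move=> r r0; have dq := is_derive_quot e0 r0.
  apply: (is_derive_eq (is_deriveM (is_derive_id r 1) (is_deriveM dq dq))).
  rewrite /= /GRing.scale/=.
  change (((fun r => r / (r + e)) * (fun r => r / (r + e))) r) with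
    ((r / (r + e)) * (r / (r + e))).
  field.
  by rewrite gt_eqF// ltr_wpDl.
Qed.

Lemma is_derive_dramp e s : 0 < e -> is_derive s 1 (dramp e) (ddramp e s).
Proof.
move=> e0; apply: (@is_derive_shift_pos_part
  (fun r => (r / (r + e)) ^+ 2 * (3 - 2 * (r / (r + e))))
  (fun r => 6 * (r / (r + e)) * (1 - r / (r + e)) * (e / (r + e) ^+ 2))).
- by rewrite mul0r expr0n mul0r.
- by rewrite mul0r mulr0 !mul0r.
- move=> r r0; have dq := is_derive_quot e0 r0.
  pose q (r : R) := r / (r + e).
  have dp : is_derive (q r) 1 (fun x => x ^+ 2 * (3 - 2 * x))
      (6 * (q r) * (1 - q r)).
    have d1 (x : R) := is_derive_id x (1 : R).
    have d3 := is_deriveB (is_derive_cst (3 : R) (q r) (1 : R))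
      (is_deriveZ 2 (d1 (q r))).
    apply: (is_derive_eq (is_deriveM (is_deriveM (d1 (q r)) (d1 (q r))) d3)).
    rewrite /= /GRing.scale/=.
    change ((cst 3 - 2 \*: id) (q r)) with (3 - 2 * q r).
    rewrite [(id * id) (q r)](_ : _ = q r * q r)//; ring.
  exact: (is_derive1_comp dp dq).
Qed.

Lemma continuous_ddramp e : 0 < e -> continuous (ddramp e).
Proof.
move=> e0 s; rewrite /ddramp /=; set r := Num.max (s - e) 0.
have re : r + e != 0 by rewrite gt_eqF// ltr_wpDl// le_max lexx orbT.
have cr : Num.max (t - e) 0 @[t --> s] --> r.
  apply: (@continuous_max _ _ (fun t : R => t - e) (cst 0)).
    by apply: cvgB; [exact: cvg_id|exact: cvg_cst].
  exact: cvg_cst.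
have cre : (Num.max (t - e) 0 + e)^-1 @[t --> s] --> (r + e)^-1.
  by apply: cvgV => //; apply: cvgD => //; exact: cvg_cst.
have cq : (Num.max (t - e) 0 / (Num.max (t - e) 0 + e)) @[t --> s] --> r / (r + e).
  exact: cvgM.
apply: cvgM; first apply: cvgM; first apply: cvgM => //.
- exact: cvg_cst.
- by apply: cvgB => //; exact: cvg_cst.
- rewrite -exprVn; under eq_fun do rewrite -exprVn.
  by apply: cvgM; [exact: cvg_cst|exact: cvgM].
Qed.

Lemma ramp_quotP e s : 0 < e -> let r := Num.max (s - e) 0 in
  let q := r / (r + e) in
  [/\ 0 <= r, 0 <= q <= 1, s <= r + e & r = q * (r + e)].
Proof.
move=> e0 r q; have r0 : 0 <= r by rewrite le_max lexx orbT.
have re : 0 < r + e by rewrite ltr_wpDl.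
split=> //.
- rewrite /q ler_pdivrMr// mul1r lerDl (ltW e0) andbT.
  by apply: divr_ge0 => //; exact: ltW.
- by rewrite -lerBlDr le_max lexx.
- by rewrite /q divfK// gt_eqF.
Qed.

Lemma ramp_eq0 e s : s <= e -> [/\ ramp e s = 0, dramp e s = 0 & ddramp e s = 0].
Proof.
move=> se; have r0 : Num.max (s - e) 0 = 0 by rewrite max_r// subr_le0.
by rewrite /ramp /dramp /ddramp r0 !mul0r !mulr0 expr0n/= !mul0r.
Qed.

Lemma ramp_bounds e s : 0 < e ->
  [/\ 0 <= dramp e s <= 1, 0 <= ddramp e s, 0 <= ramp e s,
      ramp e s <= Num.max (s - e) 0 & s <= ramp e s + 3 * e].
Proof.
move=> e0; have [] := ramp_quotP s e0; rewrite /ramp /dramp /ddramp.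
set r := Num.max _ _; set q := r / _ => r0 /andP[q0 q1] sr rq.
have q2 : q ^+ 2 <= 1 by rewrite expr_le1.
(* Hence [r - r * q ^+ 2 = e * q * (1 + q) <= 2 * e]; together with [s <= r + e] this accounts for
   the [3 * e] in the last bound. *)
have eq : r * (1 - q) = e * q.
  by rewrite mulrBr mulr1 {1}rq; ring.
split.
- rewrite mulr_ge0 ?exprn_ge0//=; last lra.
  rewrite -subr_ge0 (_ : _ - _ = (1 - q) ^+ 2 * (1 + 2 * q)); last by ring.
  by rewrite mulr_ge0 ?sqr_ge0//; lra.
- apply: mulr_ge0.
    by apply: mulr_ge0; [exact: mulr_ge0|rewrite subr_ge0].
  by apply: divr_ge0; [exact: ltW|apply/exprn_ge0/addr_ge0 => //; exact: ltW].
- by rewrite mulr_ge0// exprn_ge0.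
- by rewrite ler_piMr.
- nra.
Qed.

(** The witness is the sum of [ramp e] and its reflection. Each vanishes when its argument is at
    most [e], so at most one of them is nonzero at any point. The sign of [dpsi], that is the
    convexity of [phi], later gives the gradient term its sign. *)
Lemma smooth_abs e : 0 < e -> exists phi psi dpsi : R -> R,
  [/\ forall s, is_derive s 1 phi (psi s), forall s, is_derive s 1 psi (dpsi s),
     continuous dpsi & forall s, 0 <= dpsi s] /\
  [/\ forall s, `|psi s| <= 1, forall s, `|s| <= e -> phi s = 0 /\ psi s = 0,
      forall s, 0 <= phi s & forall s, phi s <= `|s| <= phi s + 3 * e].
Proof.
move=> e0.
exists (fun s => ramp e s + ramp e (- s)), (fun s => dramp e s - dramp e (- s)),
  (fun s => ddramp e s + ddramp e (- s)).
have dN (s : R) : is_derive s 1 (-%R : R -> R) (- 1) by exact: is_deriveNid.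
have B s := ramp_bounds s e0.
split; split.
- move=> s; have := is_derive1_comp (is_derive_ramp (- s) e0) (dN s).
  rewrite mulrN1 => d2; exact: (is_deriveD (is_derive_ramp s e0) d2).
- move=> s; have := is_derive1_comp (is_derive_dramp (- s) e0) (dN s).
  rewrite mulrN1 => d2; have := is_deriveB (is_derive_dramp s e0) d2.
  by rewrite opprK.
- move=> s; apply: cvgD; first exact: continuous_ddramp.
  apply: (@continuous_comp _ _ _ (-%R : R -> R) (ddramp e)).
    by apply: cvgN; exact: cvg_id.
  exact: continuous_ddramp.
- move=> s; have [_ ? _ _ _] := B s; have [_ ? _ _ _] := B (- s).
  exact: addr_ge0.
- move=> s; have [/andP[? ?] _ _ _ _] := B s; have [/andP[? ?] _ _ _ _] := B (- s).
  rewrite ler_norml; lra.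
- move=> s; rewrite ler_norml lerNl => /andP[/ramp_eq0[-> -> _] /ramp_eq0[-> -> _]].
  by rewrite addr0 subr0.
- move=> s; have [_ _ ? _ _] := B s; have [_ _ ? _ _] := B (- s).
  exact: addr_ge0.
(* The claim is even in [s]; for [s >= 0] the reflected ramp is 0. *)
- move=> s; wlog s0 : s / 0 <= s.
    move=> H; have [/H//|/ltW s0] := leP 0 s.
    by have := H (- s); rewrite opprK normrN (addrC (ramp e (- s))) oppr_ge0; exact.
  have [-> _ _] : [/\ ramp e (- s) = 0, dramp e (- s) = 0 & ddramp e (- s) = 0].
    by apply: ramp_eq0; lra.
  have [_ _ _ h1 h2] := B s.
  rewrite ger0_norm// addr0 h2 andbT (le_trans h1)// ge_max s0 andbT; lra.
Qed.

End smooth_abs.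

(** * The energy inequality *)

Lemma near_eq_continuous (S T : topologicalType) (f g : S -> T) x :
  (\forall y \near x, f y = g y) -> {for x, continuous f} -> {for x, continuous g}.
Proof.
move=> fg; rewrite /prop_for /continuous_at -(nbhs_singleton fg).
by apply: cvg_trans; apply: near_eq_cvg; apply: filterS fg => y ->.
Qed.

(** * Differences of functions of class C^{2,1} *)

Section C21.
Variables (R : realType) (n : nat).
Implicit Types (Q : set ('rV[R]_n * R)) (u v : 'rV[R]_n -> R -> R).

Lemma near_slicel Q x t : open Q -> Q (x, t) -> \forall y \near x, Q (y, t).
Proof.
move=> oQ Qxt; have : nbhs (x, t) Q by exact: open_nbhs_nbhs.
exact: (@continuous_pairr 'rV[R]_n R t x Q).
Qed.

Lemma jointly_continuous_onB Q u v :
  jointly_continuous_on Q u -> jointly_continuous_on Q v ->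
  jointly_continuous_on Q (fun x t => u x t - v x t).
Proof. by move=> cu cv p Qp; apply: cvgB; [exact: cu|exact: cv]. Qed.

Lemma eq_jointly_continuous_on Q u v : open Q ->
  (forall x t, Q (x, t) -> u x t = v x t) ->
  jointly_continuous_on Q u -> jointly_continuous_on Q v.
Proof.
move=> oQ uv cu [x t] Qxt; apply: near_eq_continuous (cu _ Qxt).
by apply: filterS (open_nbhs_nbhs (conj oQ Qxt)) => -[y s] /uv.
Qed.

Lemma partialB Q u v i x t : C21_on Q u -> C21_on Q v -> Q (x, t) ->
  partial i (fun x => u x t - v x t) x =
  partial i (u ^~ t) x - partial i (v ^~ t) x.
Proof.
move=> [_ _ /(_ i)[du _] _] [_ _ /(_ i)[dv _] _] Qxt.
exact: (deriveB (du _ _ Qxt) (dv _ _ Qxt)).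
Qed.

(** [partial i] is a total function whose additivity is only known on [Q]. As [Q] is open,
    additivity holds near [x] in the time slice, which is what a second differentiation requires. *)
Lemma near_partialB Q u v i x t : open Q -> C21_on Q u -> C21_on Q v ->
  Q (x, t) -> \forall y \near x,
  partial i (u ^~ t) y - partial i (v ^~ t) y =
  partial i (fun x => u x t - v x t) y.
Proof.
move=> oQ hu hv Qxt; apply: filterS (near_slicel oQ Qxt) => y Qyt.
by rewrite (partialB _ hu hv).
Qed.

Lemma partial2B Q u v i j x t : open Q -> C21_on Q u -> C21_on Q v ->
  Q (x, t) ->
  partial j (partial i (fun x => u x t - v x t)) x =
  partial j (partial i (u ^~ t)) x - partial j (partial i (v ^~ t)) x.
Proof.
move=> oQ hu hv Qxt.
rewrite -[LHS](near_eq_derive (unit_vec R j) (near_partialB i oQ hu hv Qxt)).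
case: hu hv => _ _ _ /(_ i j)[du _] [_ _ _ /(_ i j)[dv _]].
exact: (deriveB (du _ _ Qxt) (dv _ _ Qxt)).
Qed.

Lemma laplacianB Q u v x t : open Q -> C21_on Q u -> C21_on Q v ->
  Q (x, t) -> laplacian (fun x => u x t - v x t) x =
  laplacian (u ^~ t) x - laplacian (v ^~ t) x.
Proof.
move=> oQ hu hv Qxt; rewrite /laplacian -sumrB; apply: eq_bigr => i _.
exact: (partial2B _ _ oQ hu hv Qxt).
Qed.

Lemma derive1B_C21 Q u v x t : C21_on Q u -> C21_on Q v -> Q (x, t) ->
  derive1 (fun t => u x t - v x t) t = derive1 (u x) t - derive1 (v x) t.
Proof.
move=> [_ [du _] _ _] [_ [dv _] _ _] Qxt; rewrite !derive1E.
exact: (deriveB (du _ _ Qxt) (dv _ _ Qxt)).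
Qed.

Lemma C21_onB Q u v : open Q -> C21_on Q u -> C21_on Q v ->
  C21_on Q (fun x t => u x t - v x t).
Proof.
move=> oQ hu hv; have [cu [du cdu] d1u d2u] := hu; have [cv [dv cdv] d1v d2v] := hv.
split.
- exact: jointly_continuous_onB.
- split=> [x t Qxt|]; first exact: (derivableB (du _ _ Qxt) (dv _ _ Qxt)).
  apply: eq_jointly_continuous_on (jointly_continuous_onB cdu cdv) => // x t Qxt.
  by rewrite (derive1B_C21 hu hv).
- move=> i; have [du1 cu1] := d1u i; have [dv1 cv1] := d1v i.
  split=> [x t Qxt|]; first exact: (derivableB (du1 _ _ Qxt) (dv1 _ _ Qxt)).
  apply: eq_jointly_continuous_on (jointly_continuous_onB cu1 cv1) => // x t Qxt.
  by rewrite (partialB _ hu hv).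
- move=> i j; have [du2 cu2] := d2u i j; have [dv2 cv2] := d2v i j.
  split=> [x t Qxt|].
    apply: near_eq_derivable (near_partialB i oQ hu hv Qxt) _.
    exact: (derivableB (du2 _ _ Qxt) (dv2 _ _ Qxt)).
  apply: eq_jointly_continuous_on (jointly_continuous_onB cu2 cv2) => // x t Qxt.
  by rewrite (partial2B _ _ oQ hu hv).
Qed.

Lemma C21_onS Q Q' u : Q' `<=` Q -> C21_on Q u -> C21_on Q' u.
Proof.
move=> QQ [cu [du cdu] d1 d2]; split=> [p /QQ/cu//||i|i j].
- by split=> [x t /QQ/du//|p /QQ/cdu].
- by have [h1 h2] := d1 i; split=> [x t /QQ/h1//|p /QQ/h2].
- by have [h1 h2] := d2 i j; split=> [x t /QQ/h1//|p /QQ/h2].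
Qed.

Lemma jointly_continuous_slice Q (U : set 'rV[R]_n) u t :
  (forall x, U x -> Q (x, t)) -> jointly_continuous_on Q u ->
  continuous_on U (u ^~ t).
Proof.
move=> UQ cu x Ux.
exact: (@continuous_comp _ _ _ (fun x => (x, t)) (fun p => u p.1 p.2) x
  (@continuous_pairr _ _ t x) (cu _ (UQ x Ux))).
Qed.

End C21.

Lemma openX (T U : topologicalType) (A : set T) (B : set U) :
  open A -> open B -> open (A `*` B).
Proof.
move=> oA oB; rewrite openE => -[x y] [Ax By].
by exists (A, B) => //; split; exact: open_nbhs_nbhs.
Qed.

(** Continuity is relative to [A], so the preimage of [B] may fail to be closed, but it meets [A] in
    the trace of a closed set [V]. *)
Lemma compact_setI_preimage_closed (T U : topologicalType) (A : set T) (B : set U)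
    (f : T -> U) :
  compact A -> {within A, continuous f} -> closed B -> compact (A `&` f @^-1` B).
Proof.
move=> cA cf cB.
have /closed_subspaceP[V cV VA] := (continuous_closedP _).1 cf B cB.
by rewrite setIC -VA setIC; exact: compact_closedI.
Qed.

(** * Bounds and compactness for [w] on closed time slabs *)

Section energy.
Variables (R : realType) (n : nat) (Omega : set 'rV[R]_n) (T : R).
Implicit Types (s t e C : R) (x : 'rV[R]_n).
Hypotheses (oO : open Omega) (bO : bounded_set Omega).

Let mu := lebesgue_rV R n.
Let Q := Omega `*` `]0, T[.

Let mO : measurable Omega. Proof. exact: open_measurable_rV. Qed.

Let oQ : open Q. Proof. by apply: openX => //; exact: itv_open. Qed.

Lemma compact_closure_bounded : compact (closure Omega).
Proof.
have [M OM] := bounded_set_cube bO.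
apply: (subclosed_compact (@closed_closure _ _) (@compact_cube R n M)).
by rewrite (closure_id (cube M)).1; [exact: closureS|exact: closed_cube].
Qed.

Lemma lebesgue_bounded_lty : (mu Omega < +oo)%E.
Proof.
have [M OM] := bounded_set_cube bO.
apply: le_lt_trans (lebesgue_cube_lty n M).
by apply: le_measure => //; rewrite inE//; exact: measurable_cube.
Qed.

Lemma integrable_continuous_bounded f C : continuous_on Omega f ->
  (forall x, Omega x -> `|f x| <= C) -> mu.-integrable Omega (EFin \o f).
Proof.
move=> cf fC; apply: measurable_bounded_integrable => //.
- exact: lebesgue_bounded_lty.
- exact: continuous_on_measurable_fun.
- exists C; split; first exact: num_real.
  by move=> C' /ltW CC' x /fC /le_trans; exact.
Qed.

Lemma integrable_cst_bounded C : mu.-integrable Omega (EFin \o cst C).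
Proof.
apply: (@integrable_continuous_bounded _ `|C|) => // x _.
exact: cst_continuous.
Qed.

Variable w : 'rV[R]_n -> R -> R.
Hypothesis wC21 : C21_on Q w.
Hypothesis wcont : {within closure Omega `*` `]0, T[,
   continuous (fun p : 'rV[R]_n * R => w p.1 p.2)}.
Hypothesis w0 : forall x t, boundary Omega x -> 0 < t < T -> w x t = 0.

Lemma slab_compact (s1 s2 : R) : compact (closure Omega `*` `[s1, s2]).
Proof.
by apply: compact_setX; [exact: compact_closure_bounded|exact: segment_compact].
Qed.

Lemma slab_continuous (s1 s2 : R) : 0 < s1 -> s2 < T ->
  {within closure Omega `*` `[s1, s2],
    continuous (fun p : 'rV[R]_n * R => w p.1 p.2)}.
Proof.
move=> s10 s2T; apply: continuous_subspaceW wcont => -[x t] /= [Ox].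
rewrite !in_itv/= => /andP[st ts]; split=> //.
by rewrite (lt_le_trans s10)//= (le_lt_trans ts).
Qed.

Lemma slab_bounded (s1 s2 : R) : 0 < s1 -> s2 < T ->
  exists C, forall x t, closure Omega x -> s1 <= t <= s2 -> `|w x t| <= C.
Proof.
move=> s10 s2T; have [C wC] := continuous_compact_bounded (@slab_compact s1 s2)
  (slab_continuous s10 s2T).
by exists C => x t Ox ts; apply: (wC (x, t)); split.
Qed.

(** [K] is the projection to space of the compact part of the slab where the absolute value of [w]
    is at least [e]; it misses the boundary because [w] is 0 there. One [K] serves all times of the
    slab, as differentiation under the integral requires. *)
Lemma slab_support (s1 s2 e : R) : 0 < s1 -> s2 < T -> 0 < e ->
  exists K, [/\ compact K, K `<=` Omega & forall x t, ~ K x ->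
    closure Omega x -> s1 <= t <= s2 -> `|w x t| <= e].
Proof.
move=> s10 s2T e0.
pose A := (closure Omega `*` `[s1, s2]) `&`
  (fun p : 'rV[R]_n * R => w p.1 p.2) @^-1` [set y | e <= `|y|].
have cA : compact A.
  apply: compact_setI_preimage_closed (slab_continuous s10 s2T) _.
    exact: slab_compact.
  rewrite (_ : mkset _ = Num.norm @^-1` [set y : R | e <= y]).
    by apply: closed_comp; [move=> *; exact: norm_continuous|exact: closed_ge].
  by [].
exists (fst @` A); split.
- apply: continuous_compact => //; apply: continuous_subspaceT => p.
  exact: cvg_fst.
- move=> _ [[x t] /= [[Ox ts] ewx] <-]; apply: contrapT => nOx.
  move: ewx; rewrite /= w0 ?normr0 ?leNgt ?e0//.
    by split=> //; rewrite (interior_id _).1.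
  move: ts; rewrite /= in_itv/= => /andP[h1 h2].
  by rewrite (lt_le_trans s10)//= (le_lt_trans h2).
- move=> x t nK Ox ts; rewrite leNgt; apply/negP => we; apply: nK.
  by exists (x, t) => //; split=> //=; exact: ltW.
Qed.


(** * The smoothed L^1 norm and its time derivative *)

Variables (e : R) (phi psi dpsi : R -> R).
Hypothesis e0 : 0 < e.
Hypothesis dphi : forall s, is_derive s 1 phi (psi s).
Hypothesis dpsiP : forall s, is_derive s 1 psi (dpsi s).
Hypothesis cdpsi : continuous dpsi.
Hypothesis dpsi_ge0 : forall s, 0 <= dpsi s.
Hypothesis psi_le1 : forall s, `|psi s| <= 1.
Hypothesis phi_psi0 : forall s, `|s| <= e -> phi s = 0 /\ psi s = 0.
Hypothesis phi_ge0 : forall s, 0 <= phi s.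
Hypothesis phi_bound : forall s, phi s <= `|s| <= phi s + 3 * e.

Let cphi : continuous phi.
Proof.
by move=> x; apply/differentiable_continuous/derivable1_diffP; case: (dphi x).
Qed.

Let cpsi : continuous psi.
Proof.
by move=> x; apply/differentiable_continuous/derivable1_diffP; case: (dpsiP x).
Qed.

Let inQ x t : 0 < t < T -> Omega x -> Q (x, t).
Proof. by move=> tT Ox; split=> //=; rewrite in_itv. Qed.

Let cw t : 0 < t < T -> continuous_on Omega (w ^~ t).
Proof.
move=> tT; case: wC21 => cw _ _ _.
by apply: (jointly_continuous_slice _ cw) => x; exact: inQ.
Qed.

Let dw_cont t i : 0 < t < T -> continuous_on Omega (partial i (w ^~ t)).
Proof.
move=> tT; case: wC21 => _ _ /(_ i)[_ cdw] _.
by apply: (jointly_continuous_slice _ cdw) => x; exact: inQ.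
Qed.

Let ddw_cont t i : 0 < t < T ->
  continuous_on Omega (partial i (partial i (w ^~ t))).
Proof.
move=> tT; case: wC21 => _ _ _ /(_ i i)[_ cdw].
by apply: (jointly_continuous_slice _ cdw) => x; exact: inQ.
Qed.

Let near_Omega x : Omega x -> \forall y \near x, Omega y.
Proof. by move=> Ox; exact: open_nbhs_nbhs. Qed.

Definition flux t i x : R := psi (w x t) * partial i (w ^~ t) x.

(** Only the [i]-th summand of the divergence of psi(w) grad w. Its first term is nonnegative, so
    the sum over [i] bounds psi(w) times the Laplacian of w from above. *)
Definition div_flux t i x : R := dpsi (w x t) * partial i (w ^~ t) x ^+ 2 +
   psi (w x t) * partial i (partial i (w ^~ t)) x.

Lemma is_derive_flux t i x : 0 < t < T -> Omega x ->
  is_derive x (unit_vec R i) (flux t i) (div_flux t i x).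
Proof.
move=> tT Ox; case: (wC21) => _ _ /(_ i)[dw _] /(_ i i)[ddw _].
have dwx := derivableP (dw x t (inQ tT Ox)).
have ddwx := derivableP (ddw x t (inQ tT Ox)).
have dpsiw := is_derive_comp_dir (g := w ^~ t) (dpsiP (w x t)) dwx.
apply: (is_derive_eq (is_deriveM dpsiw ddwx)).
rewrite /= /div_flux /GRing.scale/= -!/(partial _ _ _); ring.
Qed.

Lemma div_flux_continuous t i : 0 < t < T -> continuous_on Omega (div_flux t i).
Proof.
move=> tT x Ox; have c := cw tT Ox; have dc := @dw_cont t i tT x Ox.
have c1 : {for x, continuous (dpsi \o (w ^~ t))}.
  by apply: continuous_comp => //; exact: cdpsi.
have c2 : {for x, continuous (psi \o (w ^~ t))}.
  by apply: continuous_comp => //; exact: cpsi.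
exact: (continuousD (continuousM c1 (continuousM dc dc))
  (continuousM c2 (@ddw_cont t i tT x Ox))).
Qed.

Lemma integral_div_flux t i : 0 < t < T ->
  mu.-integrable Omega (EFin \o div_flux t i) /\
  \int[mu]_(x in Omega) div_flux t i x = 0.
Proof.
move=> tT; have /andP[t0 tltT] := tT.
(* The slab is reduced to the single time [t]. *)
have [K [cK KO wK]] := slab_support t0 tltT e0.
have clK : closed K by apply: compact_closed => //; exact: norm_hausdorff.
have [M OM] := bounded_set_cube bO.
(* Off the compact set [K] both [psi (w x t)] and the extension by 0 vanish, so
   the extension is C^1 on the whole space. *)
pose G := flux t i \_ Omega.
have GE x : Omega x -> \forall y \near x, flux t i y = G y.
  by move=> Ox; apply: filterS (near_Omega Ox) => y Oy; rewrite /G patchE mem_set.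
have G0 x : ~ K x -> G x = 0.
  move=> Kx; rewrite /G patchE; case: ifPn => //; rewrite inE => Ox.
  rewrite /flux; have [] := phi_psi0 (wK x t Kx (subset_closure Ox) _).
    by rewrite lexx.
  by move=> _ ->; rewrite mul0r.
(* Inside [Omega], [G] agrees locally with the flux; a point outside [Omega] lies in the open
   complement of [K], where [G] vanishes identically. *)
have dG x : is_derive x (unit_vec R i) G ((div_flux t i \_ Omega) x).
  have [Ox|nOx] := pselect (Omega x).
    rewrite patchE mem_set//.
    exact: near_eq_is_derive (GE x Ox) (is_derive_flux i tT Ox).
  rewrite patchE memNset//; apply: (near_eq_is_derive (f := cst 0)).
  by apply: filterS (near_eq0_closed clK G0 (fun h => nOx (KO _ h))) => y ->.
have pG : partial i G = div_flux t i \_ Omega.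
  by apply/funext => x; rewrite /partial; case: (dG x).
have pG0 x : ~ K x -> partial i G x = 0.
  by move=> Kx; apply: near_derive0; exact: near_eq0_closed G0 Kx.
have cG : continuous (partial i G).
  move=> x; have [Ox|nOx] := pselect (Omega x).
    rewrite pG; apply: near_eq_continuous (@div_flux_continuous t i tT x Ox).
    by apply: filterS (near_Omega Ox) => y Oy; rewrite patchE mem_set.
  have nKx : ~ K x by move/KO.
  apply: near_eq_continuous (cvg_cst 0).
  by apply: filterS (near_eq0_closed clK pG0 nKx) => y ->.
have G0M x : ~ cube M x -> G x = 0 by move=> xM; apply: G0 => /KO /OM.
have := integral_partial_support0 (fun x => @ex_derive _ _ _ _ _ _ _ (dG x)) cG G0M.
have := integrable_bounded_support cG (fun x => partial_support0 i G0M).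
rewrite pG => h1 h2; split.
  apply/(integrable_mkcond _ mO); move: h1; congr (_.-integrable _ _).
  by apply/funext => x; rewrite /= !patchE; case: ifP.
rewrite Rintegral_mkcond /Rintegral; move: h2 => ->.
by [].
Qed.

Lemma norm_integrable t : 0 < t < T ->
  mu.-integrable Omega (EFin \o (fun x => `|w x t|)).
Proof.
move=> tT; have /andP[t0 tltT] := tT; have [C wC] := slab_bounded t0 tltT.
apply: (@integrable_continuous_bounded _ C) => x Ox.
  by apply: continuous_comp; [exact: cw|exact: norm_continuous].
by rewrite normr_id wC ?lexx//; exact: subset_closure.
Qed.

Let phi_integrable t : 0 < t < T ->
  mu.-integrable Omega (EFin \o (fun x => phi (w x t))).
Proof.
move=> tT; have /andP[t0 tltT] := tT; have [C wC] := slab_bounded t0 tltT.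
apply: (@integrable_continuous_bounded _ C) => x Ox.
  by apply: continuous_comp; [exact: cw|exact: cphi].
rewrite ger0_norm// (le_trans (andP (phi_bound _)).1)//.
by rewrite wC ?lexx//; exact: subset_closure.
Qed.

Definition energy t : R := \int[mu]_(x in Omega) phi (w x t).

Let w_t t x : R := derive1 (w x) t.

Lemma is_derive_phi t x : 0 < t < T -> Omega x ->
  is_derive t 1 (fun t => phi (w x t)) (psi (w x t) * w_t t x).
Proof.
move=> tT Ox; case: wC21 => _ [dw _] _ _.
have dwt := derivableP (dw x t (inQ tT Ox)); rewrite /w_t derive1E.
exact: (is_derive1_comp (dphi (w x t)) dwt).
Qed.

(** Differentiation under the integral. Nothing bounds [w_t] near the boundary, but the factor
    [psi (w x s)] vanishes off a compact [K] in [Omega], and [w_t] is bounded on [K] times a closed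
    time interval. The dominating function is thus a constant, integrable since [Omega] has finite
    measure. *)
Lemma energy_derive t : 0 < t < T ->
  [/\ derivable energy t 1,
      mu.-integrable Omega (EFin \o (fun x => psi (w x t) * w_t t x)) &
      derive1 energy t = \int[mu]_(x in Omega) (psi (w x t) * w_t t x)].
Proof.
move=> tT; have /andP[t0 tltT] := tT.
(* A closed window around [t] inside the open interval from 0 to [T], so that a single [K] and a
   single bound cover all nearby times. *)
pose s1 := t / 2; pose s2 := (t + T) / 2.
have s10 : 0 < s1 by rewrite /s1; lra.
have s2T : s2 < T by rewrite /s2; lra.
have s1t : s1 < t by rewrite /s1; lra.
have ts2 : t < s2 by rewrite /s2; lra.
have sT s : s1 <= s <= s2 -> 0 < s < T.
  by move=> /andP[h1 h2]; rewrite (lt_le_trans s10)//= (le_lt_trans h2).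
have [K [cK KO wK]] := slab_support s10 s2T e0.
have [C wtC] : exists C, forall x s, K x -> s1 <= s <= s2 -> `|w_t s x| <= C.
  case: wC21 => _ [_ cwt] _ _.
  have cKs : compact (K `*` `[s1, s2]).
    by apply: compact_setX => //; exact: segment_compact.
  have [|C hC] := continuous_compact_bounded
    (f := fun p : 'rV[R]_n * R => w_t p.2 p.1) cKs.
    apply: continuous_in_subspaceT => -[x s]; rewrite inE => -[/= Kx ss].
    by apply: (cwt (x, s)); apply: inQ;
      [apply: sT; move: ss; rewrite in_itv|exact: KO].
  by exists C => x s Kx ss; apply: (hC (x, s)); split.
have bound s x : s1 <= s <= s2 -> Omega x -> `|psi (w x s) * w_t s x| <= `|C|.
  move=> ss Ox; have [Kx|nKx] := pselect (K x).
    rewrite normrM -[leRHS]mul1r ler_pM// (le_trans (wtC _ _ Kx ss))//.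
    exact: ler_norm.
  have [_ ->] := phi_psi0 (wK x s nKx (subset_closure Ox) ss).
  by rewrite mul0r normr0.
have It : [set` `]s1, s2[] t by rewrite /= in_itv/= s1t ts2.
have ss s : [set` `]s1, s2[] s -> s1 <= s <= s2.
  by rewrite /= in_itv/= => /andP[/ltW-> /ltW->].
have intf s : [set` `]s1, s2[] s ->
    mu.-integrable Omega (EFin \o (fun x => phi (w x s))).
  by move=> /ss /sT; exact: phi_integrable.
have derf s x : [set` `]s1, s2[] s -> Omega x ->
    derivable (fun s => phi (w x s)) s 1.
  by move=> /ss /sT sT' Ox; case: (is_derive_phi sT' Ox).
have derfE s x : 0 < s < T -> Omega x ->
    partial1of2 (fun s x => phi (w x s)) s x = psi (w x s) * w_t s x.
  by move=> sT' Ox; rewrite partial1of2E; case: (is_derive_phi sT' Ox).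
have Gub s x : [set` `]s1, s2[] s -> Omega x ->
    `|partial1of2 (fun s x => phi (w x s)) s x| <= cst `|C| x.
  by move=> /ss s12 Ox; rewrite derfE ?bound// sT.
have intG : mu.-integrable Omega (EFin \o cst `|C|).
  exact: integrable_cst_bounded.
split.
- exact: (derivable_under_integral mO It intf derf (fun=> normr_ge0 C) intG Gub).
- apply: (@integrable_continuous_bounded _ `|C|) => x Ox.
    apply: continuousM.
      by apply: continuous_comp; [exact: cw|exact: cpsi].
    case: wC21 => _ [_ cwt] _ _.
    have := jointly_continuous_slice (fun y Oy => inQ tT Oy) cwt.
    by move=> /(_ x Ox).
  by rewrite bound// !ltW.
- rewrite (differentiation_under_integral mO It intf derf (fun=> normr_ge0 C)
    intG Gub).
  by apply: eq_Rintegral => x; rewrite inE => Ox; rewrite derfE.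
Qed.

(** The integrand splits along w_t = (w_t - Laplacian w) + Laplacian w. The first part is controlled
    because psi is at most 1 in absolute value; the second contributes at most the sum of the
    [div_flux], whose integral is 0. *)
Lemma energy_derive_le t L M : 0 < t < T -> 0 <= L -> 0 <= M ->
  (forall x, Omega x -> `|w_t t x - laplacian (w ^~ t) x| <= L * `|w x t| + M) ->
  derive1 energy t <= L * (\int[mu]_(x in Omega) `|w x t|) + M * fine (mu Omega).
Proof.
move=> tT L0 M0 fLM; have [_ int1 ->] := energy_derive tT.
have intM : mu.-integrable Omega (EFin \o cst M).
  exact: integrable_cst_bounded.
have intL : mu.-integrable Omega (EFin \o (fun x => L * `|w x t|)).
  exact: (integrableZl mO L (norm_integrable tT)).
have intLM : mu.-integrable Omega (EFin \o (fun x => L * `|w x t| + M)).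
  exact: (integrableD mO intL intM).
have [intdiv div0] : mu.-integrable Omega
    (EFin \o (fun x => \sum_(i < n) div_flux t i x)) /\
    \int[mu]_(x in Omega) (\sum_(i < n) div_flux t i x) = 0.
  (* Integrability and the vanishing of the integral are carried together along the list of indices,
     since additivity of the integral needs the former. *)
  elim: (index_enum _) => [|i r [intr r0]].
    under eq_fun do rewrite big_nil.
    by split; [exact: (integrable_cst_bounded 0)|rewrite Rintegral_cst ?mul0r].
  have [inti i0] := integral_div_flux i tT.
  under eq_fun do rewrite big_cons; split; first exact: (integrableD mO inti intr).
  by rewrite RintegralD// i0 r0 addr0.
(* Adding a term of integral 0 to the right-hand side makes the inequality hold pointwise between
   the integrands. *)
have -> : L * (\int[mu]_(x in Omega) `|w x t|) + M * fine (mu Omega) =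
  \int[mu]_(x in Omega) (\sum_(i < n) div_flux t i x + (L * `|w x t| + M)).
  rewrite RintegralD// div0 add0r RintegralD// Rintegral_cst//.
  by rewrite RintegralZl//; exact: norm_integrable.
apply: le_Rintegral => //.
  exact: (integrableD mO intdiv intLM).
move=> x Ox; rewrite -{1}(subrK (laplacian (w ^~ t) x) (w_t t x)) mulrDr addrC.
apply: lerD.
  rewrite /laplacian mulr_sumr; apply: ler_sum => i _.
  by rewrite lerDr mulr_ge0// sqr_ge0.
apply: le_trans (fLM x Ox); apply: le_trans (ler_norm _) _.
by rewrite normrM ler_piMl.
Qed.

Lemma energy_le t : 0 < t < T ->
  energy t <= \int[mu]_(x in Omega) `|w x t| <= energy t + 3 * e * fine (mu Omega).
Proof.
move=> tT; apply/andP; split.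
  apply: le_Rintegral => //; [exact: phi_integrable|exact: norm_integrable|].
  by move=> x Ox; have /andP[] := phi_bound (w x t).
rewrite -Rintegral_cst// -RintegralD//.
- apply: le_Rintegral => //; first exact: norm_integrable.
    exact: (integrableD mO (phi_integrable tT) (integrable_cst_bounded _)).
  by move=> x Ox; have /andP[] := phi_bound (w x t).
- exact: phi_integrable.
- exact: integrable_cst_bounded.
Qed.

End energy.

(** * Growth of the L^1 norm *)

(** Integrating factor: (E + d) exp(- C t) has derivative exp(- C t) (E' - C (E + d)), which is
    nonpositive. The shift [d] will hold the smoothing error. *)
Lemma gronwall (R : realType) (E : R -> R) (C d t1 t2 T : R) :
  (forall t, 0 < t < T -> derivable E t 1) ->
  (forall t, 0 < t < T -> derive1 E t <= C * (E t + d)) ->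
  0 < t1 -> t1 <= t2 -> t2 < T ->
  E t2 + d <= (E t1 + d) * expR (C * (t2 - t1)).
Proof.
move=> dE E'C t10 t12 t2T.
pose h (t : R) := expR (- C * t).
pose g := (E + cst d) * h.
have dh (t : R) : is_derive t 1 h (- C * h t).
  have dC : is_derive t 1 (fun t : R => - C * t) (- C).
    have d1 : is_derive t 1 (id : R -> R) 1 by exact: is_derive_id.
    by have := is_deriveZ (- C) d1; rewrite [_ *: _]mulr1.
  have := is_derive1_comp (is_derive_expR (- C * t)) dC.
  by rewrite mulrC.
have dg (t : R) : 0 < t < T ->
    is_derive t 1 g (h t * (derive1 E t - C * (E t + d))).
  move=> tT; have dEt := derivableP (dE t tT).
  have dd : is_derive t 1 (cst d : R -> R) 0 by exact: is_derive_cst.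
  have := is_deriveM (is_deriveD dEt dd) (dh t).
  rewrite -derive1E => H; apply: (is_derive_eq H).
  rewrite /= /GRing.scale/= addr0.
  change ((E + cst d) t) with (E t + d); ring.
have t12T t : t1 <= t <= t2 -> 0 < t < T.
  by move=> /andP[h1 h2]; rewrite (lt_le_trans t10)//= (le_lt_trans h2).
have : g t2 <= g t1.
  apply: (ler0_derive1_nincr (a := t1) (b := t2)) => //.
  - by move=> t; rewrite in_itv/= => /andP[/ltW h1 /ltW h2];
      have [] := dg t (t12T t (introT andP (conj h1 h2))).
  - move=> t; rewrite in_itv/= => /andP[/ltW h1 /ltW h2].
    have tT := t12T t (introT andP (conj h1 h2)).
    rewrite derive1E; have [_ ->] := dg t tT.
    by rewrite mulr_ge0_le0 ?expR_ge0// subr_le0 E'C.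
  - apply: derivable_within_continuous => t; rewrite in_itv/= => /t12T tT.
    by have [] := dg t tT.
rewrite /g /h !fctE /= => gg.
rewrite -(ler_pM2r (expR_gt0 (- C * t2))) -mulrA -expRD.
by rewrite (_ : C * (t2 - t1) + - C * t2 = - C * t1)//; ring.
Qed.

Section contraction.
Variables (R : realType) (n : nat) (Omega : set 'rV[R]_n) (T : R).
Hypotheses (oO : open Omega) (bO : bounded_set Omega).
Let mu := lebesgue_rV R n.
Variable w : 'rV[R]_n -> R -> R.
Hypothesis wC21 : C21_on (Omega `*` `]0, T[) w.
Hypothesis wcont : {within closure Omega `*` `]0, T[,
   continuous (fun p : 'rV[R]_n * R => w p.1 p.2)}.
Hypothesis w0 : forall x t, boundary Omega x -> 0 < t < T -> w x t = 0.
Variables (L M : R).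
Hypotheses (L0 : 0 <= L) (M0 : 0 <= M).
Hypothesis wLM : forall x t, Omega x -> 0 < t < T ->
  `|derive1 (w x) t - laplacian (w ^~ t) x| <=
    L * `|w x t| + M * \int[mu]_(y in Omega) `|w y t|.

(** Gronwall is applied to the energy, which differs from the L^1 norm by at most [3 * e * m]; an
    arbitrary [d > 0] absorbs this error. Integrating the nonlocal term over [Omega] multiplies it
    by [m], whence the rate [L + M * m]. *)
Lemma L1_norm_growth t1 t2 : 0 < t1 -> t1 <= t2 -> t2 < T ->
  \int[mu]_(x in Omega) `|w x t2| <=
  (\int[mu]_(x in Omega) `|w x t1|) * expR ((L + M * fine (mu Omega)) * (t2 - t1)).
Proof.
move=> t10 t12 t2T.
set N := fun t => \int[mu]_(x in Omega) `|w x t|; rewrite -!/(N _).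
set m := fine (mu Omega); have m0 : 0 <= m by apply: fine_ge0.
set C := L + M * m; set X := expR _.
have C0 : 0 <= C by rewrite addr_ge0// mulr_ge0.
have N0 t : 0 <= N t by apply: Rintegral_ge0 => x _.
have t1T : 0 < t1 < T by rewrite t10 (le_lt_trans t12).
have t2T' : 0 < t2 < T by rewrite (lt_le_trans t10).
apply/ler_addgt0Pr => d d0.
(* Chosen so that [3 * e * (m + 1) * X = d]; using [m + 1] keeps the denominator positive even when
   [m = 0]. *)
pose e := d / (3 * (m + 1) * X).
have X0 : 0 < X by exact: expR_gt0.
have e0 : 0 < e by rewrite divr_gt0// !mulr_gt0// ltr_wpDl.
have emd : 3 * e * m * X <= d.
  have -> : d = 3 * e * (m + 1) * X.
    by rewrite /e; field; rewrite (gt_eqF X0) gt_eqF// ltr_wpDl.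
  rewrite ler_pM2r// ler_pM2l ?lerDl// mulr_gt0//.
have [phi [psi [dpsi [[dphi dpsiP cdpsi dpsi0] [psi1 phi0 phige0 phib]]]]] :=
  smooth_abs e0.
pose E := energy Omega w phi.
have EN t : 0 < t < T -> E t <= N t <= E t + 3 * e * m.
  by move=> tT; exact: (energy_le oO bO wC21 wcont dphi phige0 phib tT).
have dE t : 0 < t < T -> derivable E t 1.
  move=> tT.
  by have [] := energy_derive oO bO wC21 wcont w0 e0 dphi dpsiP psi1 phi0 phige0
    phib tT.
have E'C t : 0 < t < T -> derive1 E t <= C * (E t + 3 * e * m).
  move=> tT; have /andP[_ NE] := EN t tT.
  apply: (@le_trans _ _ (C * N t)); last exact: ler_wpM2l.
  rewrite /C mulrDl -mulrA (mulrC m) mulrA.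
  have wt x (Ox : Omega x) := wLM Ox tT.
  (* The additive constant of the estimate is taken to be [M * N t], the nonlocal term frozen at
     time [t]. *)
  have := energy_derive_le oO bO wC21 wcont w0 e0 dphi dpsiP cdpsi dpsi0 psi1
    phi0 phige0 phib tT L0 (mulr_ge0 M0 (N0 t)) wt.
  by [].
have := gronwall dE E'C t10 t12 t2T; rewrite -/X => G.
have /andP[_ /le_trans->//] := EN t2 t2T'.
apply: le_trans G _; rewrite mulrDl lerD//; apply: ler_wpM2r; first exact: ltW.
by have /andP[] := EN t1 t1T.
Qed.

End contraction.

(** * The nonlocal term *)

Section nonlinearity.
Variable R : realType.

Lemma normr_sqrB_le (D p q : R) : 0 <= p <= D -> 0 <= q <= D ->
  `|p ^+ 2 - q ^+ 2| <= 2 * D * `|p - q|.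
Proof.
move=> /andP[p0 pD] /andP[q0 qD].
rewrite subr_sqr normrM mulrC (ger0_norm (addr_ge0 p0 q0)) ler_wpM2r//; lra.
Qed.

Lemma normr_mulB_le (D a1 a2 k1 k2 : R) : 0 <= a2 <= D -> 0 <= k1 <= 1 ->
  `|a1 * k1 - a2 * k2| <= `|a1 - a2| + D * `|k1 - k2|.
Proof.
move=> /andP[a0 aD] /andP[k0 k1'].
rewrite (_ : _ - _ = (a1 - a2) * k1 + a2 * (k1 - k2)); last by ring.
apply: le_trans (ler_normD _ _) _; rewrite !normrM (ger0_norm k0) (ger0_norm a0).
by apply: lerD; [rewrite ler_piMr|rewrite ler_wpM2r].
Qed.

Lemma normr_invB_le (D x y : R) : 0 < x -> 0 < y -> x^-1 <= D -> y^-1 <= D ->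
  `|x^-1 - y^-1| <= D ^+ 2 * `|x - y|.
Proof.
move=> x0 y0 xD yD.
rewrite (_ : _ - _ = (y - x) * (x^-1 * y^-1)); last by field; rewrite !gt_eqF.
rewrite normrM distrC mulrC ger0_norm; last by rewrite mulr_ge0// invr_ge0 ltW.
by rewrite ler_wpM2r// expr2 ler_pM// invr_ge0 ltW.
Qed.

Variables (n : nat) (Omega : set 'rV[R]_n).
Hypotheses (oO : open Omega) (bO : bounded_set Omega).
Let mu := lebesgue_rV R n.
Variables (lambda chi c : R) (v1 v2 : 'rV[R]_n -> R).
Hypotheses (lambda0 : 0 < lambda) (chi0 : 0 < chi) (c1 : c < 1).
Hypotheses (cv1 : continuous_on Omega v1) (cv2 : continuous_on Omega v2).
Hypotheses (v1c : forall x, Omega x -> v1 x <= c).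
Hypotheses (v2c : forall x, Omega x -> v2 x <= c).
Hypothesis int12 : mu.-integrable Omega (EFin \o (fun x => `|v1 x - v2 x|)).

Let D := (1 - c)^-1.
Let mO : measurable Omega. Proof. exact: open_measurable_rV. Qed.

Let D0 : 0 < D. Proof. by rewrite invr_gt0 subr_gt0. Qed.

Let inv_bound (v : R) : v <= c -> 0 < 1 - v /\ 0 <= (1 - v)^-1 <= D.
Proof.
move=> vc; have h : 0 < 1 - v by rewrite subr_gt0 (le_lt_trans vc).
split=> //; apply/andP; split; first by rewrite invr_ge0 ltW.
by rewrite /D lef_pV2 ?posrE ?subr_gt0 ?lerB// (le_lt_trans vc).
Qed.

Let int_inv v : continuous_on Omega v -> (forall x, Omega x -> v x <= c) ->
  mu.-integrable Omega (EFin \o (fun x => (1 - v x)^-1)).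
Proof.
move=> cv vc; apply: (@integrable_continuous_bounded _ _ _ oO bO _ D) => x Ox.
  have [h _] := inv_bound (vc x Ox).
  apply: (@continuousV _ _ (fun x => 1 - v x)); first by rewrite gt_eqF.
  by apply: continuousB; [exact: cst_continuous|exact: cv].
by have [_ /andP[h1 h2]] := inv_bound (vc x Ox); rewrite ger0_norm.
Qed.

Let kernel (v : 'rV[R]_n -> R) :=
  (1 + chi * \int[mu]_(y in Omega) (1 - v y)^-1)^-1.

Let kernel_bound v : (forall x, Omega x -> v x <= c) ->
  0 < 1 + chi * \int[mu]_(y in Omega) (1 - v y)^-1 /\ 0 <= kernel v <= 1.
Proof.
move=> vc; have I0 : 0 <= \int[mu]_(y in Omega) (1 - v y)^-1.
  by apply: Rintegral_ge0 => y Oy; have [_ /andP[]] := inv_bound (vc y Oy).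
have h : 1 <= 1 + chi * \int[mu]_(y in Omega) (1 - v y)^-1.
  by rewrite lerDl mulr_ge0// ltW.
have h0 := lt_le_trans ltr01 h.
by split=> //; rewrite /kernel invr_ge0 ltW//= invf_le1.
Qed.

(** Each term is lambda (a k)^2 with a = 1 / (1 - v x) in [0, D] and the kernel k in [0, 1].
    Squaring costs a factor 2 D, a varies by at most D^2 times the difference of the v, and k by at
    most chi D^2 times its L^1 norm; the variation of k carries one more factor D from a. This
    yields the powers D^3 and D^4. *)
Lemma nonlocal_term_lipschitz x : Omega x ->
  `|lambda / ((1 - v1 x) ^+ 2 *
      (1 + chi * \int[mu]_(y in Omega) (1 - v1 y)^-1) ^+ 2) -
    lambda / ((1 - v2 x) ^+ 2 *
      (1 + chi * \int[mu]_(y in Omega) (1 - v2 y)^-1) ^+ 2)| <=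
  2 * lambda * D ^+ 3 * `|v1 x - v2 x| +
  2 * lambda * chi * D ^+ 4 * \int[mu]_(y in Omega) `|v1 y - v2 y|.
Proof.
move=> Ox.
have [h1 a1D] := inv_bound (v1c Ox); have [h2 a2D] := inv_bound (v2c Ox).
have [g1 k1D] := kernel_bound v1c; have [g2 k2D] := kernel_bound v2c.
have E v : lambda / ((1 - v x) ^+ 2 *
      (1 + chi * \int[mu]_(y in Omega) (1 - v y)^-1) ^+ 2) =
    lambda * ((1 - v x)^-1 * kernel v) ^+ 2.
  by rewrite -exprMn -exprVn invfM.
rewrite !E -mulrBr normrM (gtr0_norm lambda0).
set a1 := (1 - v1 x)^-1; set a2 := (1 - v2 x)^-1.
set N := \int[mu]_(y in Omega) `|v1 y - v2 y|.
have akD a k : 0 <= a <= D -> 0 <= k <= 1 -> 0 <= a * k <= D.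
  move=> /andP[a0 aD] /andP[k0 k1]; rewrite mulr_ge0//=.
  by rewrite (le_trans _ aD)// ler_piMr.
have da : `|a1 - a2| <= D ^+ 2 * `|v1 x - v2 x|.
  have := normr_invB_le h1 h2 (andP a1D).2 (andP a2D).2.
  by rewrite (_ : 1 - v1 x - (1 - v2 x) = - (v1 x - v2 x)) ?normrN//; ring.
have dI : `|\int[mu]_(y in Omega) (1 - v1 y)^-1 -
              \int[mu]_(y in Omega) (1 - v2 y)^-1|
    <= D ^+ 2 * N.
  rewrite -RintegralB//; [|exact: int_inv..].
  apply: le_trans (le_normr_Rintegral mO _) _.
    exact: (integrableB mO (int_inv cv1 v1c) (int_inv cv2 v2c)).
  rewrite /N -RintegralZl//; apply: le_Rintegral => //.
  - apply/(integrable_norm (f := (fun x => (1 - v1 x)^-1 - (1 - v2 x)^-1))).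
    exact: (integrableB mO (int_inv cv1 v1c) (int_inv cv2 v2c)).
  - exact: (integrableZl mO _ int12).
  - move=> y Oy.
    have [h1' b1D] := inv_bound (v1c Oy); have [h2' b2D] := inv_bound (v2c Oy).
    have := normr_invB_le h1' h2' (andP b1D).2 (andP b2D).2.
    by rewrite (_ : 1 - v1 y - (1 - v2 y) = - (v1 y - v2 y)) ?normrN//; ring.
have dk : `|kernel v1 - kernel v2| <= chi * (D ^+ 2 * N).
  (* Both kernels are at most 1, so inversion is applied here with Lipschitz constant 1. *)
  apply: le_trans (normr_invB_le g1 g2 (andP k1D).2 (andP k2D).2) _.
  rewrite expr1n mul1r.
  rewrite (_ : _ - _ = chi * (\int[mu]_(y in Omega) (1 - v1 y)^-1 -
     \int[mu]_(y in Omega) (1 - v2 y)^-1)); last by ring.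
  by rewrite normrM (gtr0_norm chi0) ler_pM2l.
have dp := normr_sqrB_le (akD _ _ a1D k1D) (akD _ _ a2D k2D).
have dm := normr_mulB_le a1 (kernel v2) a2D k1D.
apply: (@le_trans _ _ (lambda *
  (2 * D * (D ^+ 2 * `|v1 x - v2 x| + D * (chi * (D ^+ 2 * N)))))).
  rewrite ler_pM2l//; apply: le_trans dp _.
  rewrite ler_pM2l ?mulr_gt0//; apply: le_trans dm _.
  by apply: lerD => //; rewrite ler_pM2l.
by rewrite le_eqVlt; apply/orP; left; apply/eqP; ring.
Qed.

End nonlinearity.

(** * Uniqueness *)

Lemma ereal_sup_lt1_bound (R : realType) (S : set (\bar R)) :
  (ereal_sup S < 1)%E -> exists2 c : R, c < 1 & forall y : R, S y%:E -> y <= c.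
Proof.
case E : (ereal_sup S) => [r| |] // S1; last first.
  (* If the supremum is -oo, [S] contains no real number and any [c < 1] serves. *)
  by exists 0 => // y /ereal_sup_ubound; rewrite E leeNy_eq.
by exists r => // y /ereal_sup_ubound; rewrite E lee_fin.
Qed.

(** A vanishing integral makes [f] zero almost everywhere. If [f x] were nonzero, continuity would
    keep [f] nonzero on a ball around [x], and the ball contains a box of positive measure. *)
Lemma continuous_Rintegral_norm_eq0 (R : realType) n (Omega : set 'rV[R]_n)
    (f : 'rV[R]_n -> R) x :
  open Omega -> continuous_on Omega f ->
  (lebesgue_rV R n).-integrable Omega (EFin \o (fun x => `|f x|)) ->
  \int[lebesgue_rV R n]_(y in Omega) `|f y| <= 0 -> Omega x -> f x = 0.
Proof.
move=> oO cf intf f0 Ox; apply: contrapT => /eqP fx.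
have mO := open_measurable_rV oO.
have : (\int[lebesgue_rV R n]_(y in Omega) `|(f y)%:E| = 0)%E.
  (* Finiteness ensures that the real-valued integral is the true one and not the default 0 assigned
     to an infinite integral. *)
  have If : (\int[lebesgue_rV R n]_(y in Omega) `|(f y)%:E|)%E \is a fin_num.
    exact: (integrable_fin_num mO intf).
  apply/eqP; rewrite eq_le integral_ge0// andbT -(fineK If) lee_fin.
  exact: f0.
have mf : measurable_fun Omega (EFin \o f).
  by apply/measurable_EFinP; exact: continuous_on_measurable_fun.
move/(ae_eq_integral_abs (lebesgue_rV R n) mO mf) => [N [mN N0 fN]].
have : \forall y \near x, Omega y /\ f y != 0.
  apply: filterI; first exact: open_nbhs_nbhs.
  have H := cf x Ox; exact: (cvgr_neq0 (f x) H fx).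
move=> /nbhs_ballP[e /= e0 xe].
(* Half-width [e / 2] keeps the closed box inside the open sup-norm ball of radius [e]; all its
   sides have length [e]. *)
pose a := \row_(i < n) (x ord0 i - e / 2).
pose b := \row_(i < n) (x ord0 i + e / 2).
have ab : forall i, a ord0 i <= b ord0 i by move=> i; rewrite !mxE; lra.
pose B : set 'rV[R]_n :=
  [set y : 'rV[R]_n | forall i, y ord0 i \in `[a ord0 i, b ord0 i]].
have mB : measurable B by exact: (measurable_box (a ord0) (b ord0)).
have muB : lebesgue_rV R n B = _ := lebesgue_rV_box ab.
have BN : B `<=` N.
  move=> y By; apply: fN => /= fy0.
  have [|Oy fy] := xe y.
    split=> // i j; rewrite ord1 /ball/= ltr_distlC.
    have := By j; rewrite in_itv/= !mxE => /andP[h1 h2]; lra.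
  by have := fy0 Oy => -[] /eqP; rewrite (negbTE fy).
have : (lebesgue_rV R n B <= 0)%E.
  by rewrite -N0; apply: le_measure => //; rewrite inE.
rewrite muB lee_fin leNgt prodr_gt0// => i _; rewrite !mxE; lra.
Qed.

(** Both bounds hold on right neighbourhoods of 0, hence at a common time. This provides an instant
    at which both solutions are close to the initial value in L^1. *)
Lemma cvg0_lt (R : realType) (F G : R -> \bar R) (d t0 : R) :
  F t @[t --> (0 : R)^'+] --> 0%E -> G t @[t --> (0 : R)^'+] --> 0%E ->
  0 < d -> 0 < t0 ->
  exists t, [/\ 0 < t, t < t0, (F t < d%:E)%E & (G t < d%:E)%E].
Proof.
move=> F0 G0 d0 t00.
have small H : H t @[t --> (0 : R)^'+] --> 0%E ->
    \forall t \near (0 : R)^'+, (H t < d%:E)%E.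
  move=> /fine_cvgP[Hf H0]; have Hd := cvgr_lt _ H0 _ d0.
  near=> t; have Hft : H t \is a fin_num by near: t.
  by rewrite -(fineK Hft) lte_fin; near: t; exact: Hd.
near (0 : R)^'+ => t; exists t; split; near: t.
- exact: nbhs_right_gt.
- exact: nbhs_right_lt.
- exact: small.
- exact: small.
Unshelve. all: by end_near. Qed.

Theorem theorem2p1 (R : realType) (n : nat) (hn : (0 < n)%N)
    (Omega : set 'rV[R]_n) (hOmega : bounded_C2_domain Omega)
    (u0 : 'rV[R]_n -> R)
    (hu0 : (lebesgue_rV R n).-integrable Omega (fun x => (u0 x)%:E))
    (b1 a : R) (hb1 : 0 <= b1) (ha0 : 0 < a) (ha1 : a < 1)
    (hu0_bd : {ae lebesgue_rV R n, forall x : 'rV[R]_n, Omega x -> - b1 <= u0 x <= a})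
    (lambda chi T : R) (hlambda : 0 < lambda) (hchi : 0 < chi) (hT : 0 < T)
    (u1 u2 : 'rV[R]_n -> R -> R)
    (hu1 : is_solution Omega u0 lambda chi T u1)
    (hu2 : is_solution Omega u0 lambda chi T u2) :
  forall (x : 'rV[R]_n) (t : R), Omega x -> 0 < t < T -> u1 x t = u2 x t.
Proof.
move=> x t Ox /andP[t0 tT].
have [oO _ _ bO _] := hOmega.
have mO := open_measurable_rV oO.
have [C1 W1 [_ eq1 bd1 sup1 ini1]] := hu1.
have [C2 W2 [_ eq2 bd2 sup2 ini2]] := hu2.
(* Strictly between [t] and [T]: the suprema up to [T'] are below 1, which yields one constant
   [c < 1] bounding both solutions up to a time beyond [t]. *)
pose T' := (t + T) / 2.
have tT' : t < T' by rewrite /T'; lra.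
have T'T : T' < T by rewrite /T'; lra.
have T'0 : 0 < T' < T by rewrite (lt_trans t0).
have ltT s : 0 < s < T' -> 0 < s < T by move=> /andP[-> /lt_trans->].
have [c c1 [u1c u2c]] : exists2 c : R, c < 1 &
    (forall y s, Omega y -> 0 < s < T' -> u1 y s <= c) /\
    (forall y s, Omega y -> 0 < s < T' -> u2 y s <= c).
  have [d1 d11 h1] := ereal_sup_lt1_bound (sup1 T' T'0).
  have [d2 d21 h2] := ereal_sup_lt1_bound (sup2 T' T'0).
  exists (Num.max d1 d2); first by rewrite gt_max d11.
  by split=> y s Oy /andP[s0 sT]; rewrite le_max; apply/orP;
    [left; apply: h1|right; apply: h2];
    exists y; rewrite /=; [exact: subset_closure| |exact: subset_closure|];
    exists s; rewrite //= in_itv/= s0 ltW.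
pose w y s := u1 y s - u2 y s.
pose Q := Omega `*` `]0, T'[.
have oQ : open Q by apply: openX => //; exact: itv_open.
have QQ : Q `<=` Omega `*` `]0, T[.
  move=> [y s] [Oy]; rewrite /= !in_itv/= => sT.
  by split=> //=; rewrite ?in_itv/= ltT.
have C1' := C21_onS QQ C1; have C2' := C21_onS QQ C2.
have wC21 : C21_on Q w by exact: C21_onB.
have SS : closure Omega `*` `]0, T'[ `<=` closure Omega `*` `]0, T[.
  move=> [y s] [Oy]; rewrite /= !in_itv/= => sT.
  by split=> //=; rewrite ?in_itv/= ltT.
have wcont : {within closure Omega `*` `]0, T'[,
    continuous (fun p : 'rV[R]_n * R => w p.1 p.2)}.
  move=> p; apply: continuousB.
    exact: (continuous_subspaceW SS W1).
  exact: (continuous_subspaceW SS W2).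
have w0 y s : boundary Omega y -> 0 < s < T' -> w y s = 0.
  by move=> By /ltT sT; rewrite /w bd1// bd2// subrr.
have inQ y s : Omega y -> 0 < s < T' -> Q (y, s).
  by move=> Oy sT; split=> //=; rewrite ?in_itv.
have cs u s : C21_on Q u -> 0 < s < T' -> continuous_on Omega (u ^~ s).
  move=> [cu _ _ _] sT; apply: (jointly_continuous_slice _ cu) => y Oy.
  exact: inQ.
have intw s : 0 < s < T' ->
    (lebesgue_rV R n).-integrable Omega (EFin \o (fun y => `|w y s|)).
  exact: (norm_integrable oO bO wC21 wcont).
have C0 : 0 < (1 - c)^-1 by rewrite invr_gt0 subr_gt0.
(* [L] and [M] are the local and nonlocal constants of [nonlocal_term_lipschitz]. *)
pose L := 2 * lambda * (1 - c)^-1 ^+ 3.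
pose M := 2 * lambda * chi * (1 - c)^-1 ^+ 4.
have L0 : 0 <= L by rewrite !mulr_ge0 ?exprn_ge0// ltW.
have M0 : 0 <= M by rewrite !mulr_ge0 ?exprn_ge0// ltW.
have wLM y s : Omega y -> 0 < s < T' ->
  `|derive1 (w y) s - laplacian (w ^~ s) y| <=
    L * `|w y s| + M * \int[lebesgue_rV R n]_(z in Omega) `|w z s|.
  move=> Oy sT.
  rewrite (derive1B_C21 C1' C2' (inQ _ _ Oy sT)).
  rewrite (laplacianB oQ C1' C2' (inQ _ _ Oy sT)).
  (* After substitution of both equations the Laplacians cancel and only the difference of the
     reaction terms remains. *)
  rewrite eq1 ?ltT// eq2 ?ltT//.
  set A1 := lambda / _; set A2 := lambda / _.
  rewrite (_ : _ - _ = A1 - A2); last by ring.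
  apply: nonlocal_term_lipschitz => //; try exact: cs.
  - by move=> z Oz; exact: u1c.
  - by move=> z Oz; exact: u2c.
  - exact: intw.
pose N s := \int[lebesgue_rV R n]_(y in Omega) `|w y s|.
pose C := L + M * fine (lebesgue_rV R n Omega).
have C_ge0 : 0 <= C by rewrite addr_ge0// mulr_ge0// fine_ge0.
have Nt : N t <= 0.
  apply/ler_addgt0Pr => d d0; rewrite add0r.
  (* [X] bounds the growth factor from any time [s] in the interval from 0 to [t]. Taking [s] with
     both solutions within [d / (2 * X)] of [u0] gives [N s <= d / X], and growth up to [t] then
     gives at most [d]. *)
  pose X := expR (C * t); have X0 : 0 < X by exact: expR_gt0.
  have dX : 0 < d / (2 * X) by rewrite divr_gt0// mulr_gt0.
  have [s [s0 st h1 h2]] := cvg0_lt ini1 ini2 dX t0.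
  have sT' : 0 < s < T' by rewrite s0 (lt_trans st).
  have Ns : N s <= d / X.
    have mw u : C21_on Q u -> measurable_fun Omega (fun y => (`|u y s - u0 y|)%:E).
      move=> /cs /(_ sT') cu; apply/measurable_EFinP; apply: measurableT_comp => //.
      apply: measurable_funB; first exact: continuous_on_measurable_fun.
      by apply/measurable_EFinP; have /integrableP[] := hu0.
    (* The triangle inequality through [u0] is integrated in the extended reals, by additivity for
       nonnegative measurable functions, and carried back to the real integral by the integrability
       of [w]. *)
    have : (\int[lebesgue_rV R n]_(y in Omega) (`|w y s|)%:E <= (d / X)%:E)%E.
      rewrite (_ : d / X = d / (2 * X) + d / (2 * X)); last first.
        by field; rewrite gt_eqF.
      rewrite EFinD; apply: le_trans (leeD (ltW h1) (ltW h2)).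
      rewrite -ge0_integralD//; [|exact: mw..].
      apply: ge0_le_integral => //.
      - by case: (integrableP _ _ _ (intw s sT')).
      - by apply: emeasurable_funD; exact: mw.
      - move=> y Oy; rewrite -EFinD lee_fin /w.
        rewrite (_ : u1 y s - u2 y s = u1 y s - u0 y - (u2 y s - u0 y)).
          exact: ler_normB.
        by ring.
    by rewrite -(fineK (integrable_fin_num mO (intw s sT'))) lee_fin.
  apply: le_trans (L1_norm_growth oO bO wC21 wcont w0 L0 M0 wLM s0 (ltW st) tT') _.
  apply: (@le_trans _ _ (d / X * X)); last by rewrite divfK// gt_eqF.
  apply: ler_pM => //.
  - exact: Rintegral_ge0.
  - rewrite ler_expR ler_wpM2l//; lra.
apply/eqP; rewrite -subr_eq0; apply/eqP.
apply: (continuous_Rintegral_norm_eq0 oO (f := w ^~ t)) Nt Ox.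
- by apply: cs => //; rewrite t0.
- by apply: intw; rewrite t0.
Qed.
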